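(* Let $n\ge1$ and let $L$ be a self-adjoint Lindbladian on the matrix algebra $\mathbb M_n$, i.e. $$L(x)=\sum_{j=1}^k (a_j^2x+xa_j^2-2a_jxa_j),\qquad x\in\mathbb M_n,$$ for some self-adjoint $a_1,\dots,a_k\in\mathbb M_n$. Then $\mathrm{CLSI}(L)>0$; that is, there is $\lambda>0$ such that for every integer $\ell\ge1$ and every positive operator $\rho\in\mathbb M_n\otimes\mathbb M_\ell$, $$\lambda\,\mathrm{tr}\big(\rho\log\rho-\rho\log (E_N\otimes\mathrm{id}_{\mathbb M_\ell})(\rho)\big)\le \mathrm{tr}\big((L\otimes\mathrm{id}_{\mathbb M_\ell})(\rho)\,\log\rho\big).$$
   Context: $\mathbb M_n$ is the algebra of complex $n\times n$ matrices and $\mathrm{tr}$ the matrix trace. $T_t=e^{-tL}$ is a semigroup of completely positive, unital, trace preserving maps, symmetric for the trace inner product; its fixed point algebra is the commutant $N=\{a_1,\dots,a_k\}'$, and $E_N:\mathbb M_n\to N$ is the trace preserving conditional expectation (the orthogonal projection onto $N$ for the trace inner product). $\mathrm{CLSI}(L)$ is the largest (supremum of) $\lambda$ for which the displayed inequality holds for all $\ell\ge 1$ and all positive $\rho\in\mathbb M_n\otimes\mathbb M_\ell$. (It is equivalent to require it for positive definite $\rho$, the general case being understood by a limit.) *)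

(* Defs.v *)
From HB Require Import structures.
From mathcomp Require Import all_boot all_order all_algebra.
From mathcomp Require Import spectral sesquilinear complex mxtens.
From mathcomp Require Import all_classical all_reals all_analysis.

Set Implicit Arguments.
Unset Strict Implicit.
Unset Printing Implicit Defensive.

Import Order.TTheory GRing.Theory Num.Theory.
Import numFieldNormedType.Exports.

Local Open Scope ring_scope.
Local Open Scope complex_scope.
Local Open Scope classical_set_scope.
Local Open Scope sesquilinear_scope.

Section Definitions.
Context {R : realType}.
Local Notation C := R[i].

(* 0 <= z in C means that z is real and nonnegative, so both notions below
   entail that A is Hermitian. *)
Definition posmx m (A : 'M[C]_m) : Prop :=
  forall u : 'rV[C]_m, 0 <= (u *m A *m u^t*) 0 0.

Definition posdefmx m (A : 'M[C]_m) : Prop :=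
  forall u : 'rV[C]_m, u != 0 -> 0 < (u *m A *m u^t*) 0 0.

(* Functional calculus through the spectral decomposition
   A = P^-1 diag(d) P; the logarithm is meant for positive definite A. *)
Definition mxlog m (A : 'M[C]_m) : 'M[C]_m :=
  invmx (spectralmx A)
  *m diag_mx (map_mx (fun z : C => (ln (complex.Re z))%:C) (spectral_diag A))
  *m spectralmx A.

Definition lindblad n k (a : 'I_k -> 'M[C]_n) (x : 'M[C]_n) : 'M[C]_n :=
  \sum_j (a j *m a j *m x + x *m (a j *m a j) - 2%:R *: (a j *m x *m a j)).

(* The row space of the result is { mxvec x | x a_j = a_j x for all j }. *)
Definition commutant n k (a : 'I_k -> 'M[C]_n) :=
  cent_mx (\matrix_(j < k) mxvec (a j)).

(* Orthogonal projection onto N for the inner product tr (x y^t* ), which is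
   the standard inner product of the vectors mxvec x and mxvec y. *)
Definition condexp n m (N : 'A[C]_(m, n)) (x : 'M[C]_n) : 'M[C]_n :=
  vec_mx (mxvec x *m proj_ortho N).

(* M_n (x) M_l is 'M_(n * l), with A (x) B encoded as A *t B. *)
Definition block n l (X : 'M[C]_(n * l)) (p q : 'I_l) : 'M[C]_n :=
  \matrix_(i, j) X (mxtens_index (i, p)) (mxtens_index (j, q)).

Definition tensid n l (Phi : 'M[C]_n -> 'M[C]_n) (X : 'M[C]_(n * l)) :
    'M[C]_(n * l) :=
  \sum_p \sum_q tensmx (Phi (block X p q)) (delta_mx p q).

Definition relent n m l (N : 'A[C]_(m, n)) (rho : 'M[C]_(n * l)) : C :=
  \tr (rho *m mxlog rho - rho *m mxlog (tensid (condexp N) rho)).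

Definition entprod n l (L : 'M[C]_n -> 'M[C]_n) (rho : 'M[C]_(n * l)) : C :=
  \tr (tensid L rho *m mxlog rho).

Definition regularize m (rho : 'M[C]_m) (e : R) : 'M[C]_m := rho + (e%:C)%:M.

(* For positive definite rho this is the inequality itself. For an arbitrary
   positive rho both sides are limits along rho + e 1 as e tends to 0+; they
   are extended reals, since the right-hand side may be +oo. *)
Definition clsi_ineq n m (L : 'M[C]_n -> 'M[C]_n) (N : 'A[C]_(m, n))
    (lambda : R) : Prop :=
  forall (l : nat) (rho : 'M[C]_(n * l)), (0 < l)%N ->
    (posdefmx rho -> lambda%:C * relent N rho <= entprod L rho) /\
    (posmx rho ->
     (lambda%:E *
        lim ((complex.Re (relent N (regularize rho e)))%:E @[e --> 0^'+]) <=
      lim ((complex.Re (entprod L (regularize rho e)))%:E @[e --> 0^'+]))%E).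

Definition CLSI n m (L : 'M[C]_n -> 'M[C]_n) (N : 'A[C]_(m, n)) : \bar R :=
  ereal_sup [set lambda%:E | lambda in [set lambda | clsi_ineq L N lambda]].

Lemma commutantP n k (a : 'I_k -> 'M[C]_n) (x : 'M[C]_n) :
  (x \in commutant a)%MS <-> forall j, x *m a j = a j *m x.
Proof.
split=> [/cent_rowP cx j|cx].
  by have := cx j; rewrite rowK mxvecK.
by apply/cent_rowP => j; rewrite rowK mxvecK.
Qed.

Lemma condexp_in n m (N : 'A[C]_(m, n)) (x : 'M[C]_n) :
  (condexp N x \in N)%MS.
Proof. by rewrite /condexp vec_mxK proj_ortho_sub. Qed.

Lemma mxtrace_mxvec n (x y : 'M[C]_n) :
  \tr (x *m y^t*) = (mxvec x *m (mxvec y)^t*) 0 0.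
Proof.
rewrite /mxtrace mxE (reindex _ (curry_mxvec_bij n n)) /=.
transitivity (\sum_i \sum_j x i j * (y i j)^*%R).
  by apply: eq_bigr => i _; rewrite mxE; apply: eq_bigr => j _; rewrite !mxE.
rewrite pair_bigA /=; apply: eq_bigr => -[i j] _ /=.
by rewrite ![in RHS]mxE !mxvecE.
Qed.

Lemma condexp_orth n m (N : 'A[C]_(m, n)) (x y : 'M[C]_n) :
  (y \in N)%MS -> \tr ((x - condexp N x) *m y^t*) = 0.
Proof.
move=> /submxP[w yw]; rewrite mxtrace_mxvec linearB /= vec_mxK yw.
have /orthomx1P := proj_ortho_compl_sub N (mxvec x).
by rewrite trmx_mul map_mxM mulmxA => ->; rewrite mul0mx mxE.
Qed.

Lemma mxlogE m (U : 'M[C]_m) (d : 'rV[C]_m) : U \is unitarymx ->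
  mxlog (invmx U *m diag_mx d *m U) =
  invmx U *m diag_mx (map_mx (fun z : C => (ln (complex.Re z))%:C) d) *m U.
Proof.
move=> uU; set A := invmx U *m diag_mx d *m U.
have U_unit := unitarymx_unit uU.
have /orthomx_spectralP : A \is normalmx.
  by apply/orthomx_spectral_subproof; exists (U, d).
rewrite /mxlog; move: (spectral_unit A).
move: (spectralmx A) (spectral_diag A) => P s P_unit AE.
set f := fun z : C => _.
pose W := P *m invmx U.
have sW : diag_mx s *m W = W *m diag_mx d.
  have -> : diag_mx s *m W = P *m A *m invmx U.
    by rewrite AE !mulmxA mulmxV // mul1mx.
  by rewrite /A !mulmxA mulmxK.
have fW : diag_mx (map_mx f s) *m W = W *m diag_mx (map_mx f d).
  clearbody W; apply/matrixP => i j; move/matrixP/(_ i j): sW.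
  rewrite !mul_diag_mx !mul_mx_diag !mxE; move: (W i j) => w.
  have [->|w0] := eqVneq w 0; first by rewrite !mulr0 !mul0r.
  by rewrite mulrC => /(mulfI w0) ->; rewrite mulrC.
have PE : P = W *m U by rewrite /W mulmxKV.
rewrite {2}PE mulmxA -(mulmxA (invmx P)) fW /W !mulmxA mulVmx //.
by rewrite mul1mx.
Qed.

Lemma tensid_tens n l (Phi : {linear 'M[C]_n -> 'M[C]_n})
    (A : 'M[C]_n) (B : 'M[C]_l) :
  tensid Phi (tensmx A B) = tensmx (Phi A) B.
Proof.
rewrite /tensid; have -> : tensmx (Phi A) B =
    \sum_p \sum_q B p q *: tensmx (Phi A) (delta_mx p q).
  apply/matrixP => i j; rewrite mxE {1}[B]matrix_sum_delta summxE mulr_sumr.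
  rewrite summxE; apply: eq_bigr => p _; rewrite !summxE mulr_sumr.
  by apply: eq_bigr => q _; rewrite !mxE mulrCA.
apply: eq_bigr => p _; apply: eq_bigr => q _.
have -> : block (tensmx A B) p q = B p q *: A.
  by apply/matrixP => i j; rewrite !mxE !mxtens_indexK mulrC.
by rewrite linearZ; apply/matrixP => i j; rewrite !mxE mulrA.
Qed.

End Definitions.

(* Main.v *)
(* Write sigma = E(rho), x = rho - sigma and I(rho) = tr(L(rho) log rho).
   Differentiating log(A + s) in s turns inequalities between logarithms into
   inequalities between resolvents, and -I(rho + s)' is the sum of the
   tr([a_j, rho] (rho + s)^-1 [a_j, rho]^* (rho + s)^-1).
   A complete Pimsner-Popa inequality rho <= c sigma bounds this below by the
   same expression with (sigma + s)^-1 in place of (rho + s)^-1; as sigma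
   commutes with the a_j, the spectral gap of L bounds the latter below by
   tr(x (sigma + s)^-1 x (sigma + s)^-1), uniformly in the ampliation.
   The same quantity bounds from above minus the derivative of
   tr x (log (B + x/2) - log B) as soon as B >= sigma, so that the relative
   entropy is at most a multiple of I(rho) by telescoping along the dyadic
   points (1 - 2^-n) rho + 2^-n sigma of the segment from sigma to rho. *)
Require Import Defs.
From HB Require Import structures.
From mathcomp Require Import all_boot all_order all_algebra.
From mathcomp Require Import spectral sesquilinear complex mxtens.
From mathcomp Require Import all_classical all_reals all_analysis.
From mathcomp Require Import ring lra.

Set Implicit Arguments.
Unset Strict Implicit.
Unset Printing Implicit Defensive.

Import Order.TTheory GRing.Theory Num.Theory.
Import numFieldNormedType.Exports.

Local Open Scope ring_scope.
Local Open Scope complex_scope.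
Local Open Scope classical_set_scope.
Local Open Scope sesquilinear_scope.

(** * Positive matrices and traces *)

Section MatrixBasics.
Context {R : realType}.
Local Notation C := R[i].

(** The obstacle is that the points of the segment other than sigma need not commute with the a_j,
    so that a gap argument has no hold on their resolvents. Everything is therefore compared with
    sigma: replacing its two resolvents by those of rho costs c^2, while the resolvent of B + x/2
    costs a factor 2 that the step length 1/2 absorbs. The point (1 - e) rho + e sigma equals e B
    with B = sigma + (1/e - 1) rho, so B >= sigma however close the point is to rho, and the scalar
    e is invisible to the difference of traces against x because tr x = 0. Halving e adds x/2 to B.
    The resulting bound does not depend on e and enters with weight e; the weights 1, 1/2, 1/4, ...
    sum to 2. With g the spectral gap, the constant is g / (2 c^2). Neither number sees the
    ampliation: g comes from L on the matrices of size n, and c from one Choi projection. *)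

Fact adjmx_key : unit. Proof. exact: tt. Qed.
Definition adjmx m n : 'M[C]_(m, n) -> 'M[C]_(n, m) :=
  locked_with adjmx_key (fun A => A^t*).

Lemma adjmxE m n (A : 'M[C]_(m, n)) : adjmx A = A^t*.
Proof. by rewrite /adjmx unlock. Qed.

Notation "A ^H" := (adjmx A) (at level 8, format "A ^H").

Lemma adjK m n (A : 'M[C]_(m, n)) : A^H^H = A.
Proof. by rewrite !adjmxE trmxCK. Qed.

Lemma adjM m n p (A : 'M[C]_(m, n)) (B : 'M[C]_(n, p)) :
  (A *m B)^H = B^H *m A^H.
Proof. by rewrite !adjmxE trmx_mul map_mxM. Qed.

Lemma adjD m n (A B : 'M[C]_(m, n)) : (A + B)^H = A^H + B^H.
Proof. by rewrite !adjmxE linearD /= map_mxD. Qed.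

Lemma adjN m n (A : 'M[C]_(m, n)) : (- A)^H = - A^H.
Proof. by rewrite !adjmxE linearN /= map_mxN. Qed.

Lemma adjB m n (A B : 'M[C]_(m, n)) : (A - B)^H = A^H - B^H.
Proof. by rewrite adjD adjN. Qed.

Lemma adjZ m n (c : R) (A : 'M[C]_(m, n)) : (c%:C *: A)^H = c%:C *: A^H.
Proof.
rewrite !adjmxE linearZ /= map_mxZ; congr (_ *: _); exact: conjc_real.
Qed.

Lemma adj1 m : (1%:M : 'M[C]_m)^H = 1%:M.
Proof. by rewrite adjmxE trmx1 map_mx1. Qed.

Lemma adj_sum m n (I : finType) (F : I -> 'M[C]_(m, n)) :
  (\sum_i F i)^H = \sum_i (F i)^H.
Proof.
by rewrite adjmxE linear_sum /= map_mx_sum; apply: eq_bigr => i _; rewrite adjmxE.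
Qed.

Lemma tr_adj m (A : 'M[C]_m) : \tr (A^H) = (\tr A)^*%R.
Proof.
by rewrite adjmxE /mxtrace rmorph_sum; apply: eq_bigr => i _; rewrite !mxE.
Qed.

Lemma posmxE m (A : 'M[C]_m) :
  posmx A <-> forall u : 'rV_m, 0 <= (u *m A *m u^H) 0 0.
Proof. by split=> pA u; have := pA u; rewrite adjmxE. Qed.

Lemma posdefmxE m (A : 'M[C]_m) :
  posdefmx A <-> forall u : 'rV_m, u != 0 -> 0 < (u *m A *m u^H) 0 0.
Proof. by split=> pA u /pA; rewrite adjmxE. Qed.

Lemma hermsymmx_adj m (A : 'M[C]_m) : A \is hermsymmx -> A^H = A.
Proof. by rewrite adjmxE => /is_hermitianmxP; rewrite expr0 scale1r => {2}->. Qed.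

Lemma mx_form_eq0 m n (A : 'M[C]_(m, n)) :
  (forall (u : 'rV_m) (v : 'rV_n), (u *m A *m v^H) 0 0 = 0) -> A = 0.
Proof.
move=> A0; apply/matrixP => i j; rewrite [RHS]mxE.
have := A0 (delta_mx 0 i) (delta_mx 0 j).
rewrite adjmxE -rowE trmx_delta map_delta_mx -colE.
by rewrite !mxE.
Qed.

(** Polarisation: the form q of A - A^H vanishes on the diagonal since that of A is real there.
    Testing u + v makes q antisymmetric, replacing v by i v makes it symmetric, hence q = 0. *)
Lemma posmx_adj m (A : 'M[C]_m) : posmx A -> A^H = A.
Proof.
move=> pA; pose q (u v : 'rV[C]_m) := (u *m (A - A^H) *m v^H) 0 0.
have q0 u : q u u = 0.
  have /ger0_Im := (posmxE A).1 pA u.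
  have e : u *m A^H *m u^H = (u *m A *m u^H)^H.
    by rewrite !adjM adjK mulmxA.
  rewrite /q mulmxBr mulmxBl e; move: (u *m A *m u^H) => M.
  rewrite adjmxE !mxE; case: (M 0 0) => x y /= ->; apply/eqP.
  by rewrite subr_eq0 eq_complex /= oppr0 !eqxx.
have qDD u v : q u v + q v u = 0.
  have := q0 (u + v).
  have -> : q (u + v) (u + v) = q u u + q v u + (q u v + q v v).
    rewrite /q; move: (A - A^H) => B.
    rewrite adjD mulmxDl mulmxDl !mulmxDr mxE [X in X + _]mxE [X in _ + X]mxE.
    by rewrite addrACA.
  by rewrite !q0 add0r addr0 addrC.
have qZ u v : q ('i%C *: u) v = 'i%C * q u v by rewrite /q -!scalemxAl mxE.
have qZ' u v : q u ('i%C *: v) = - 'i%C * q u v.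
  rewrite /q (adjmxE (_ *: _)) linearZ /= map_mxZ -adjmxE -scalemxAr mxE; congr (_ * _).
  by simpc.
apply/esym/eqP; rewrite -subr_eq0; apply/eqP; apply: mx_form_eq0 => u v.
rewrite -/(q u v).
have e1 := qDD u v; have := qDD u ('i%C *: v); rewrite qZ qZ' mulNr.
move/eqP; rewrite addrC subr_eq0 => /eqP/mulfI e2.
have i0 : 'i%C != 0 :> C by rewrite eq_complex /= eqxx oner_eq0.
move: e1; rewrite (e2 i0) -mulr2n => /eqP; rewrite mulrn_eq0 /= => /eqP //.
Qed.

Lemma posdef_posmx m (A : 'M[C]_m) : posdefmx A -> posmx A.
Proof.
move=> pA u; have [->|/pA/ltW//] := eqVneq u 0.
by rewrite !mul0mx mxE.
Qed.

Lemma posmxD m (A B : 'M[C]_m) : posmx A -> posmx B -> posmx (A + B).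
Proof. by move=> pA pB u; rewrite mulmxDr mulmxDl mxE addr_ge0. Qed.

Lemma posdefmxD m (A B : 'M[C]_m) : posdefmx A -> posmx B -> posdefmx (A + B).
Proof. by move=> pA pB u u0; rewrite mulmxDr mulmxDl mxE ltr_wpDr// pA. Qed.

Lemma posmx_sum m (I : finType) (F : I -> 'M[C]_m) :
  (forall i, posmx (F i)) -> posmx (\sum_i F i).
Proof.
move=> pF u; rewrite mulmx_sumr mulmx_suml summxE.
by apply: sumr_ge0 => i _; exact: pF.
Qed.

Lemma posmxZ m (c : R) (A : 'M[C]_m) : 0 <= c -> posmx A -> posmx (c%:C *: A).
Proof.
by move=> c0 pA u; rewrite -scalemxAr -scalemxAl mxE mulr_ge0 ?ler0c.
Qed.

Lemma posdefmxZ m (c : R) (A : 'M[C]_m) :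
  0 < c -> posdefmx A -> posdefmx (c%:C *: A).
Proof.
move=> c0 pA u u0; rewrite -scalemxAr -scalemxAl mxE mulr_gt0 ?pA//.
by rewrite ltcR.
Qed.

Lemma posmx_conj m n (A : 'M[C]_m) (V : 'M[C]_(n, m)) :
  posmx A -> posmx (V *m A *m V^H).
Proof.
move=> pA; apply/posmxE => u.
by have := (posmxE A).1 pA (u *m V); rewrite adjM !mulmxA.
Qed.

Lemma posmx1 m : posmx (1%:M : 'M[C]_m).
Proof.
move=> u; rewrite mulmx1 mxE sumr_ge0// => i _.
by rewrite !mxE mulcJ_ge0.
Qed.

Lemma posdefmx1 m : posdefmx (1%:M : 'M[C]_m).
Proof.
by move=> u u0; rewrite mulmx1 -dotmxE; exact: dotmx_is_dotmx.
Qed.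

Lemma posdefmx_scalar m (s : R) : 0 < s -> posdefmx ((s%:C)%:M : 'M[C]_m).
Proof.
by move=> s0; rewrite -scalemx1; apply: posdefmxZ => //; exact: posdefmx1.
Qed.

Lemma posmx_scalar m (s : R) : 0 <= s -> posmx ((s%:C)%:M : 'M[C]_m).
Proof. by move=> s0; rewrite -scalemx1; apply: posmxZ => //; exact: posmx1. Qed.

Lemma posmx_regularize m (A : 'M[C]_m) (s : R) :
  0 < s -> posmx A -> posdefmx (regularize A s).
Proof.
move=> s0 pA; rewrite /regularize addrC.
by apply: posdefmxD => //; exact: posdefmx_scalar.
Qed.

Lemma posdefmx_regularize m (A : 'M[C]_m) (s : R) :
  0 <= s -> posdefmx A -> posdefmx (regularize A s).
Proof. by move=> s0 pA; apply: posdefmxD => //; exact: posmx_scalar. Qed.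

Lemma posdefmx_unit m (A : 'M[C]_m) : posdefmx A -> A \in unitmx.
Proof.
move=> pA; rewrite -row_free_unit; apply/inj_row_free => v vA.
by apply: contraTeq isT => /pA; rewrite vA mul0mx mxE ltxx.
Qed.

Lemma posmx_gram m n (V : 'M[C]_(n, m)) : posmx (V *m V^H).
Proof. by rewrite -[V in V *m _]mulmx1; apply/posmx_conj/posmx1. Qed.

Fact rtr_key : unit. Proof. exact: tt. Qed.
(** The real part makes all trace estimates live in the ordered field [R]; [tr_hermM] recovers the
    complex trace of a product of two Hermitian matrices. *)
Definition rtr m : 'M[C]_m -> R :=
  locked_with rtr_key (fun A => complex.Re (\tr A)).

Lemma rtrE m (A : 'M[C]_m) : rtr A = complex.Re (\tr A).
Proof. by rewrite /rtr unlock. Qed.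

Lemma rtrD m (A B : 'M[C]_m) : rtr (A + B) = rtr A + rtr B.
Proof. by rewrite !rtrE linearD raddfD. Qed.

Lemma rtrN m (A : 'M[C]_m) : rtr (- A) = - rtr A.
Proof. by rewrite !rtrE linearN raddfN. Qed.

Lemma rtrZ m (c : R) (A : 'M[C]_m) : rtr (c%:C *: A) = c * rtr A.
Proof. by rewrite !rtrE linearZ /=; case: (\tr A) => a b; simpc. Qed.

Lemma rtrB m (A B : 'M[C]_m) : rtr (A - B) = rtr A - rtr B.
Proof. by rewrite rtrD rtrN. Qed.

Lemma rtr0 m : rtr (0 : 'M[C]_m) = 0.
Proof. by rewrite !rtrE linear0. Qed.

Lemma rtrC m n (A : 'M[C]_(m, n)) (B : 'M[C]_(n, m)) :
  rtr (A *m B) = rtr (B *m A).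
Proof. by rewrite !rtrE mxtrace_mulC. Qed.

Lemma tr_hermM m (A B : 'M[C]_m) : A^H = A -> B^H = B ->
  \tr (A *m B) = (rtr (A *m B))%:C.
Proof.
move=> hA hB; have := tr_adj (A *m B); rewrite adjM hA hB mxtrace_mulC !rtrE.
case: (\tr _) => a b /= [] /eqP; rewrite -addr_eq0 -mulr2n mulrn_eq0 /=.
by move/eqP->.
Qed.

Lemma rtr_gram_ge0 m n (V : 'M[C]_(m, n)) : 0 <= rtr (V *m V^H).
Proof.
rewrite !rtrE /mxtrace raddf_sum sumr_ge0// => i _.
rewrite mxE raddf_sum sumr_ge0// => j _.
by rewrite adjmxE !mxE; case: (V i j) => a b; simpc; rewrite addr_ge0 ?sqr_ge0.
Qed.

Lemma rtr_gram_eq0 m n (V : 'M[C]_(m, n)) : rtr (V *m V^H) = 0 -> V = 0.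
Proof.
move=> V0; apply/matrixP => i j; rewrite mxE; move: V0.
rewrite !rtrE /mxtrace raddf_sum => /eqP; rewrite psumr_eq0 => [|k _]; last first.
  rewrite mxE raddf_sum sumr_ge0// => l _.
  by rewrite adjmxE !mxE; case: (V k l) => a b; simpc; rewrite addr_ge0 ?sqr_ge0.
move=> /allP/(_ i (mem_index_enum _)) /=.
rewrite mxE raddf_sum psumr_eq0 => [|l _]; last first.
  by rewrite adjmxE !mxE; case: (V i l) => a b; simpc; rewrite addr_ge0 ?sqr_ge0.
move=> /allP/(_ j (mem_index_enum _)) /=.
rewrite adjmxE !mxE; case: (V i j) => a b; simpc.
by rewrite paddr_eq0 ?sqr_ge0// !sqrf_eq0 => /andP[/eqP-> /eqP->].
Qed.

End MatrixBasics.

Notation "A ^H" := (adjmx A) (at level 8, format "A ^H") : ring_scope.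

(** * Functional calculus of Hermitian matrices *)

Section FunctionalCalculus.
Context {R : realType}.
Local Notation C := R[i].

Fact fcalc_key : unit. Proof. exact: tt. Qed.
(** One calculus for the logarithm, inverse, square root, negative part and kernel projection, all
    in the same eigenbasis. *)
Definition fcalc m (f : R -> R) : 'M[C]_m -> 'M[C]_m :=
  locked_with fcalc_key (fun A => invmx (spectralmx A)
    *m diag_mx (map_mx (fun z : C => (f (complex.Re z))%:C) (spectral_diag A))
    *m spectralmx A).

Lemma mxlog_fcalc m (A : 'M[C]_m) : mxlog A = fcalc (@ln R) A.
Proof. by rewrite /fcalc unlock. Qed.

Fact rdiag_key : unit. Proof. exact: tt. Qed.
Definition rdiag m : ('I_m -> R) -> 'M[C]_m :=
  locked_with rdiag_key (fun d => diag_mx (\row_i (d i)%:C)).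

Lemma rdiag_diag_mx m (d : 'I_m -> R) : rdiag d = diag_mx (\row_i (d i)%:C).
Proof. by rewrite /rdiag unlock. Qed.

Lemma rdiagE m (d : 'I_m -> R) i j : rdiag d i j = (d i)%:C *+ (i == j).
Proof. by rewrite rdiag_diag_mx !mxE; case: eqP => [->|]. Qed.

Lemma rdiag_adj m (d : 'I_m -> R) : (rdiag d)^H = rdiag d.
Proof.
apply/matrixP => i j; rewrite adjmxE mxE mxE !rdiagE eq_sym.
by case: eqP => [->|_]; [exact: conjc_real|exact: conjc0].
Qed.

Lemma rdiagM m (d e : 'I_m -> R) :
  rdiag d *m rdiag e = rdiag (fun i => d i * e i).
Proof.
rewrite !rdiag_diag_mx mulmx_diag; congr diag_mx; apply/rowP => i.
by rewrite !mxE rmorphM.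
Qed.

Lemma rdiagD m (d e : 'I_m -> R) :
  rdiag d + rdiag e = rdiag (fun i => d i + e i).
Proof. by apply/matrixP => i j; rewrite mxE !rdiagE rmorphD mulrnDl. Qed.

Lemma rdiagZ m (c : R) (d : 'I_m -> R) :
  c%:C *: rdiag d = rdiag (fun i => c * d i).
Proof. by apply/matrixP => i j; rewrite mxE !rdiagE rmorphM mulrnAr. Qed.

Lemma rdiag_cst m (c : R) : rdiag (fun _ : 'I_m => c) = (c%:C)%:M.
Proof. by apply/matrixP => i j; rewrite rdiagE mxE. Qed.

Lemma eq_rdiag m (d e : 'I_m -> R) : d =1 e -> rdiag d = rdiag e.
Proof. by move=> de; apply/matrixP => i j; rewrite !rdiagE de. Qed.

Lemma unit_conjM' m n p (U : 'M[C]_m) (A : 'M[C]_(n, m)) (B : 'M[C]_(m, p)) :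
  U *m U^H = 1%:M -> A *m U *m (U^H *m B) = A *m B.
Proof. by move=> UU; rewrite mulmxA -(mulmxA A) UU mulmx1. Qed.

Lemma spectral_herm m (A : 'M[C]_m) : A^H = A ->
  exists (U : 'M[C]_m) (d : 'I_m -> R),
  [/\ U *m U^H = 1%:M, U^H *m U = 1%:M, A = U^H *m rdiag d *m U &
    forall f, fcalc f A = U^H *m rdiag (f \o d) *m U].
Proof.
move=> hA; have hermA : A \is hermsymmx.
  by apply/is_hermitianmxP; rewrite expr0 scale1r -adjmxE hA.
have /orthomx_spectralP AE := hermitian_normalmx hermA.
have /mxOverP dr := hermitian_spectral_diag_real hermA.
have uU := spectral_unitarymx A.
have UI : (spectralmx A)^H = invmx (spectralmx A).
  by rewrite adjmxE invmx_unitary.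
exists (spectralmx A), (fun i => complex.Re (spectral_diag A 0 i)).
rewrite UI; split.
- by rewrite mulmxV ?spectral_unit.
- by rewrite mulVmx ?spectral_unit.
- rewrite {1}AE; congr (_ *m _ *m _); rewrite rdiag_diag_mx; congr diag_mx.
  by apply/rowP => i; rewrite mxE RRe_real.
- move=> f; rewrite /fcalc unlock; congr (_ *m _ *m _).
  by rewrite rdiag_diag_mx; congr diag_mx; apply/rowP => i; rewrite !mxE.
Qed.

(** Entrywise, d_i W_ij = W_ij e_j forces W_ij = 0 or d_i = e_j, so any [f] may be applied, without
    continuity or polynomial approximation. *)
Lemma rdiag_intertwine m p (d : 'I_m -> R) (e : 'I_p -> R) (f : R -> R)
    (W : 'M[C]_(m, p)) :
  rdiag d *m W = W *m rdiag e -> rdiag (f \o d) *m W = W *m rdiag (f \o e).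
Proof.
move=> sW; apply/matrixP => i j; move/matrixP/(_ i j): sW.
rewrite !rdiag_diag_mx !mul_diag_mx !mul_mx_diag !mxE; move: (W i j) => w.
have [->|w0] := eqVneq w 0; first by rewrite !mulr0 !mul0r.
by rewrite mulrC => /(mulfI w0) /complexI /= ->; rewrite mulrC.
Qed.

Lemma spectral_intertwine m p (f : R -> R) (U : 'M[C]_m) (V : 'M[C]_p)
    (d : 'I_m -> R) (e : 'I_p -> R) (X : 'M[C]_(m, p)) :
  U *m U^H = 1%:M -> V *m V^H = 1%:M ->
  (U^H *m rdiag d *m U) *m X = X *m (V^H *m rdiag e *m V) ->
  (U^H *m rdiag (f \o d) *m U) *m X = X *m (V^H *m rdiag (f \o e) *m V).
Proof.
move=> UU VV AX; have U'U := mulmx1C UU; have V'V := mulmx1C VV.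
have : rdiag d *m (U *m X *m V^H) = (U *m X *m V^H) *m rdiag e.
  have -> : rdiag d *m (U *m X *m V^H) =
      U *m ((U^H *m rdiag d *m U) *m X) *m V^H.
    by rewrite !mulmxA UU mul1mx.
  by rewrite AX !mulmxA -[LHS]mulmxA VV mulmx1.
move=> /(rdiag_intertwine f)/(congr1 (fun Y => U^H *m Y *m V)).
rewrite !mulmxA U'U mul1mx => <-.
by rewrite -[RHS]mulmxA V'V mulmx1.
Qed.

Lemma fcalc_intertwine m p (f : R -> R) (A : 'M[C]_m) (B : 'M[C]_p)
    (X : 'M[C]_(m, p)) : A^H = A -> B^H = B ->
  A *m X = X *m B -> fcalc f A *m X = X *m fcalc f B.
Proof.
move=> /spectral_herm[U [d [UU _ -> ->]]] /spectral_herm[V [e [VV _ -> ->]]].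
exact: spectral_intertwine.
Qed.

(** The calculus does not depend on the chosen diagonalisation: two of them are intertwined by the
    identity matrix. *)
Lemma fcalcE m (f : R -> R) (U : 'M[C]_m) (d : 'I_m -> R) :
  U *m U^H = 1%:M ->
  fcalc f (U^H *m rdiag d *m U) = U^H *m rdiag (f \o d) *m U.
Proof.
move=> UU; have hA : (U^H *m rdiag d *m U)^H = U^H *m rdiag d *m U.
  by rewrite !adjM rdiag_adj adjK mulmxA.
have [V [e [VV _ AE ->]]] := spectral_herm hA.
have := @spectral_intertwine _ _ f V U e d 1%:M VV UU.
by rewrite -AE !mulmx1 !mul1mx => ->.
Qed.

Lemma fcalc_adj m f (A : 'M[C]_m) : A^H = A -> (fcalc f A)^H = fcalc f A.
Proof.
move=> /spectral_herm[U [d [UU U'U AE ->]]].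
by rewrite !adjM rdiag_adj adjK mulmxA.
Qed.

Lemma fcalcM m f g (A : 'M[C]_m) : A^H = A ->
  fcalc f A *m fcalc g A = fcalc (fun x => f x * g x) A.
Proof.
move=> /spectral_herm[U [d [UU _ _ fE]]].
by rewrite !fE -[U^H *m _ *m U in X in _ *m X]mulmxA unit_conjM'// mulmxA
  -(mulmxA U^H) rdiagM.
Qed.

Lemma fcalcD m f g (A : 'M[C]_m) : A^H = A ->
  fcalc f A + fcalc g A = fcalc (fun x => f x + g x) A.
Proof.
move=> /spectral_herm[U [d [UU U'U AE fE]]].
by rewrite !fE -mulmxDl -mulmxDr rdiagD.
Qed.

Lemma fcalcZ m (c : R) f (A : 'M[C]_m) : A^H = A ->
  c%:C *: fcalc f A = fcalc (fun x => c * f x) A.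
Proof.
move=> /spectral_herm[U [d [UU U'U AE fE]]].
by rewrite !fE scalemxAl scalemxAr rdiagZ.
Qed.

Lemma fcalc_id m (A : 'M[C]_m) : A^H = A -> fcalc id A = A.
Proof. by move=> /spectral_herm[U [d [UU U'U AE fE]]]; rewrite fE {1}AE. Qed.

Lemma fcalc_cst m (c : R) (A : 'M[C]_m) : A^H = A ->
  fcalc (fun=> c) A = (c%:C)%:M.
Proof.
move=> /spectral_herm[U [d [UU U'U AE fE]]].
by rewrite fE rdiag_cst scalar_mxC -mulmxA U'U mulmx1.
Qed.

Lemma fcalc_comm m f (A X : 'M[C]_m) : A^H = A ->
  A *m X = X *m A -> fcalc f A *m X = X *m fcalc f A.
Proof. by move=> hA; exact: fcalc_intertwine. Qed.

Lemma fcalc_affine m f (c s : R) (A : 'M[C]_m) : A^H = A ->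
  fcalc f (c%:C *: A + (s%:C)%:M) = fcalc (fun x => f (c * x + s)) A.
Proof.
move=> /spectral_herm[U [d [UU U'U AE fE]]].
have -> : c%:C *: A + (s%:C)%:M = U^H *m rdiag (fun i => c * d i + s) *m U.
  rewrite -rdiagD rdiag_cst -rdiagZ mulmxDr mulmxDl.
  have -> : U^H *m (s%:C)%:M *m U = (s%:C)%:M.
    by rewrite scalar_mxC -mulmxA U'U mulmx1.
  by rewrite -scalemxAr -scalemxAl -AE.
by rewrite fcalcE.
Qed.

Lemma spectral_posmx m (A : 'M[C]_m) (U : 'M[C]_m) (d : 'I_m -> R) :
  U *m U^H = 1%:M -> A = U^H *m rdiag d *m U -> posmx A ->
  forall i, 0 <= d i.
Proof.
move=> UU -> pA i; have := (posmxE _).1 pA (row i U).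
rewrite rowE adjM !mulmxA -(mulmxA _ U) UU mulmx1 -!mulmxA (mulmxA U) UU mul1mx.
by rewrite adjmxE trmx_delta map_delta_mx mulmxA -rowE -colE rdiag_diag_mx !mxE eqxx mulr1n ler0c.
Qed.

Lemma spectral_posdefmx m (A : 'M[C]_m) (U : 'M[C]_m) (d : 'I_m -> R) :
  U *m U^H = 1%:M -> A = U^H *m rdiag d *m U -> posdefmx A ->
  forall i, 0 < d i.
Proof.
move=> UU -> pA i.
have u0 : row i U != 0.
  apply/eqP => /(congr1 (fun v => v *m U^H)); rewrite -row_mul UU mul0mx.
  by move=> /rowP/(_ i); rewrite !mxE eqxx => /eqP; rewrite oner_eq0.
have := (posdefmxE _).1 pA _ u0.
rewrite rowE adjM !mulmxA -(mulmxA _ U) UU mulmx1 -!mulmxA (mulmxA U) UU mul1mx.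
by rewrite adjmxE trmx_delta map_delta_mx mulmxA -rowE -colE rdiag_diag_mx !mxE eqxx mulr1n ltcR.
Qed.

Lemma posmx_rdiag m (d : 'I_m -> R) : (forall i, 0 <= d i) -> posmx (rdiag d).
Proof.
move=> d0 u; rewrite -mulmxA mxE sumr_ge0// => i _.
rewrite rdiag_diag_mx mul_diag_mx !mxE mulrCA mulr_ge0 ?ler0c//.
exact: mulcJ_ge0.
Qed.

Lemma fcalc_posmx m f (A : 'M[C]_m) : posmx A ->
  (forall x, 0 <= x -> 0 <= f x) -> posmx (fcalc f A).
Proof.
move=> pA f0; have [U [d [UU U'U AE ->]]] := spectral_herm (posmx_adj pA).
rewrite -{2}(adjK U); apply: posmx_conj; apply: posmx_rdiag => i.
by apply/f0/(spectral_posmx UU AE pA).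
Qed.

Lemma fcalc_posmx_herm m f (A : 'M[C]_m) : A^H = A ->
  (forall x, 0 <= f x) -> posmx (fcalc f A).
Proof.
move=> hA f0; have [U [d [UU U'U AE ->]]] := spectral_herm hA.
by rewrite -{2}(adjK U); apply: posmx_conj; apply: posmx_rdiag => i /=.
Qed.

Lemma eq_fcalc_posdef m f g (A : 'M[C]_m) : posdefmx A ->
  (forall x, 0 < x -> f x = g x) -> fcalc f A = fcalc g A.
Proof.
move=> pA fg.
have [U [d [UU U'U AE fE]]] := spectral_herm (posmx_adj (posdef_posmx pA)).
rewrite !fE (@eq_rdiag _ (f \o d) (g \o d))// => i /=.
by apply/fg/(spectral_posdefmx UU AE pA).
Qed.

Lemma eq_fcalc_pos m f g (A : 'M[C]_m) : posmx A ->
  (forall x, 0 <= x -> f x = g x) -> fcalc f A = fcalc g A.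
Proof.
move=> pA fg.
have [U [d [UU U'U AE fE]]] := spectral_herm (posmx_adj pA).
rewrite !fE (@eq_rdiag _ (f \o d) (g \o d))// => i /=.
by apply/fg/(spectral_posmx UU AE pA).
Qed.

Lemma invmx_uniq m (A B : 'M[C]_m) : A *m B = 1%:M -> invmx A = B.
Proof.
move=> AB; have [uA _] := mulmx1_unit AB.
by rewrite -[RHS]mul1mx -(mulVmx uA) -mulmxA AB mulmx1.
Qed.

Lemma invmx_fcalc m (A : 'M[C]_m) : posdefmx A ->
  invmx A = fcalc GRing.inv A.
Proof.
move=> pA; have hA := posmx_adj (posdef_posmx pA).
apply: invmx_uniq; rewrite -{1}(fcalc_id hA) fcalcM// -(fcalc_cst 1 hA).
by apply: eq_fcalc_posdef => // x x0; rewrite mulfV ?gt_eqF.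
Qed.

Lemma posmx_sqrt m (A : 'M[C]_m) : posmx A -> exists T : 'M[C]_m,
  [/\ T^H = T, A = T *m T & forall X, A *m X = X *m A -> T *m X = X *m T].
Proof.
move=> pA; have hA := posmx_adj pA.
exists (fcalc Num.sqrt A); split; first exact: fcalc_adj.
  rewrite fcalcM// -{1}(fcalc_id hA).
  by apply: eq_fcalc_pos => // x x0; rewrite -expr2 sqr_sqrtr.
by move=> X; exact: fcalc_comm.
Qed.

Lemma rtr_mul_posmx m (A B : 'M[C]_m) : posmx A -> posmx B ->
  0 <= rtr (A *m B).
Proof.
move=> /posmx_sqrt[S [hS -> _]] /posmx_sqrt[T [hT -> _]].
rewrite mulmxA rtrC !mulmxA -mulmxA.
have -> : S *m T = (T *m S)^H by rewrite adjM hS hT.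
exact: rtr_gram_ge0.
Qed.

(** The weights are the real parts of the diagonal of [X] in an eigenbasis of [A]. They do not
    depend on [f], so trace inequalities become inequalities between weighted scalar sums. *)
Lemma rtr_fcalc m (A X : 'M[C]_m) : A^H = A -> exists d w : 'I_m -> R,
  [/\ posdefmx A -> forall i, 0 < d i, posmx A -> forall i, 0 <= d i,
    rtr X = \sum_i w i &
    forall f, rtr (X *m fcalc f A) = \sum_i w i * f (d i)].
Proof.
move=> /spectral_herm[U [d [UU U'U AE fE]]].
exists d, (fun i => complex.Re ((U *m X *m U^H) i i)); split.
- exact: spectral_posdefmx UU AE.
- exact: spectral_posmx UU AE.
- transitivity (rtr (U *m X *m U^H)); last by rewrite rtrE raddf_sum.
  by rewrite rtrC mulmxA U'U mul1mx.
- move=> f; rewrite fE mulmxA rtrC !mulmxA rtrE raddf_sum; apply: eq_bigr => i _.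
  rewrite rdiag_diag_mx mul_mx_diag !mxE /=.
  by case: (\sum_j _) => a b; simpc.
Qed.

End FunctionalCalculus.

(** * From resolvents to logarithms *)

Section Comparison.
Context {R : realType}.
Local Notation C := R[i].

Lemma sum_ln_is_derive (I : finType) (w d : I -> R) (s : R) :
  (forall i, 0 < d i + s) ->
  is_derive s 1 (fun t => \sum_i w i * ln (d i + t)) (\sum_i w i / (d i + s)).
Proof.
move=> ds; elim: (index_enum I) => [|i r IH].
  rewrite big_nil (_ : (fun _ => _) = cst 0); first exact: is_derive_cst.
  by apply/funext => t; rewrite big_nil.
rewrite big_cons.
rewrite (_ : (fun _ => _) = (fun t => w i * ln (d i + t)) +
    (fun t => \sum_(j <- r) w j * ln (d j + t))); last first.
  by apply/funext => t; rewrite big_cons.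
apply: is_deriveD.
rewrite (_ : (fun _ => _) = w i *: (@ln R \o (fun t => d i + t))); last first.
  exact/funext.
apply: is_deriveZ; rewrite -[X in is_derive _ _ _ X]mulr1.
apply: is_derive1_comp; first exact: is_derive1_ln.
rewrite -[X in is_derive _ _ _ X]add0r.
by apply: is_deriveD.
Qed.

Lemma sum_ln_mono (I : finType) (w d : I -> R) (s t : R) :
  s <= t -> (forall i, 0 < d i + s) ->
  (forall r, s <= r -> 0 <= \sum_i w i / (d i + r)) ->
  \sum_i w i * ln (d i + s) <= \sum_i w i * ln (d i + t).
Proof.
move=> st ds dw.
have D x : s <= x -> is_derive x 1 (fun t => \sum_i w i * ln (d i + t))
    (\sum_i w i / (d i + x)).
  by move=> sx; apply: sum_ln_is_derive => i; rewrite (lt_le_trans (ds i))// lerD2l.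
have [x| |c cst e] := @MVT_segment R (fun t => \sum_i w i * ln (d i + t))
  (fun x => \sum_i w i / (d i + x)) s t st.
- by rewrite in_itv /= => /andP[/ltW sx _]; exact: D.
- apply: derivable_within_continuous => x; rewrite in_itv /= => /andP[sx _].
  by have [] := D x sx.
- rewrite -subr_ge0 e mulr_ge0 ?subr_ge0// dw//.
  by move: cst; rewrite in_itv /= => /andP[].
Qed.

Lemma sum_ln_anti (I : finType) (w d : I -> R) (s t : R) :
  s <= t -> (forall i, 0 < d i + s) ->
  (forall r, s <= r -> \sum_i w i / (d i + r) <= 0) ->
  \sum_i w i * ln (d i + t) <= \sum_i w i * ln (d i + s).
Proof.
move=> st ds dw; rewrite -lerN2 -!sumrN.
under eq_bigr do rewrite -mulNr; under [X in _ <= X]eq_bigr do rewrite -mulNr.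
apply: (@sum_ln_mono _ (fun i => - w i)) => // r sr.
by under eq_bigr do rewrite mulNr; rewrite sumrN oppr_ge0 dw.
Qed.

Lemma ln_shift_bounds (d s : R) : 0 < d -> 0 < s ->
  0 <= ln (d + s) - ln s <= d / s.
Proof.
move=> d0 s0; rewrite -ln_div ?posrE ?addr_gt0// mulrDl divff ?gt_eqF//.
have ds : 0 < d / s by rewrite divr_gt0.
rewrite ln_ge0 ?lerDr ?(ltW ds)//= addrC le_ln1Dx//.
by rewrite (lt_trans (ltrN10 _)).
Qed.

(* The weights sum to 0, so sum_i w_i ln (d_i + s) tends to 0 at infinity. *)
Lemma sum_ln_le0 (I : finType) (w d : I -> R) :
  (forall i, 0 < d i) -> \sum_i w i = 0 ->
  (forall r, 0 <= r -> 0 <= \sum_i w i / (d i + r)) ->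
  \sum_i w i * ln (d i) <= 0.
Proof.
move=> d0 w0 dw; pose M := \sum_i `|w i| * d i.
have M0 : 0 <= M by apply: sumr_ge0 => i _; rewrite mulr_ge0// (ltW (d0 i)).
have bnd s : 0 < s -> \sum_i w i * ln (d i) <= M / s.
  move=> s0; have := @sum_ln_mono _ w d 0 s (ltW s0).
  under [X in _ -> _ -> X <= _]eq_bigr do rewrite addr0.
  move=> /(_ _ dw) le; apply: (le_trans (le _)) => [i|]; first by rewrite addr0.
  have -> : \sum_i w i * ln (d i + s) = \sum_i w i * (ln (d i + s) - ln s).
    under [RHS]eq_bigr do rewrite mulrBr.
    by rewrite sumrB -mulr_suml w0 mul0r subr0.
  rewrite /M mulr_suml; apply: ler_sum => i _.
  have /andP[l0 l1] := ln_shift_bounds (d0 i) s0.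
  apply: (le_trans (ler_norm _)); rewrite normrM -mulrA ler_wpM2l//.
  by rewrite ger0_norm.
rewrite leNgt; apply/negP => S0; set S := \sum_i _ in S0 bnd.
have M1 : 0 < M + 1 by rewrite ltr_wpDl.
have := bnd ((M + 1) / S) (divr_gt0 M1 S0).
rewrite invf_div mulrA ler_pdivlMr// mulrC ler_pM2r//.
by rewrite gerDl ler10.
Qed.

Lemma eq_fcalc m (f g : R -> R) (A : 'M[C]_m) :
  f =1 g -> fcalc f A = fcalc g A.
Proof. by move=> /funext->. Qed.

Lemma fcalc_regularize m f (s : R) (A : 'M[C]_m) : A^H = A ->
  fcalc f (regularize A s) = fcalc (fun x => f (x + s)) A.
Proof.
move=> hA; have := fcalc_affine f 1 s hA; rewrite scale1r => ->.
by apply: eq_fcalc => x; rewrite mul1r.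
Qed.

Lemma fcalc_add_affine m f (c s : R) (A : 'M[C]_m) : A^H = A ->
  fcalc f A + (c%:C *: A + (s%:C)%:M) = fcalc (fun x => f x + (c * x + s)) A.
Proof.
move=> hA; have e : c%:C *: A + (s%:C)%:M = fcalc (fun x => c * x + s) A.
  apply: etrans (fcalcD (fun x => c * x) (fun=> s) hA).
  apply: (congr2 +%R); last exact/esym/fcalc_cst.
  exact: etrans (congr1 (fun B => c%:C *: B) (esym (fcalc_id hA))) (fcalcZ c id hA).
exact: etrans (congr1 (+%R (fcalc f A)) e) (fcalcD f (fun x => c * x + s) hA).
Qed.

(** Each [A j] is diagonalised in its own basis and the spectra are pooled into one sum over J x
    'I_m. A family is allowed because a half step compares three logarithms at once. *)
Lemma rtr_ln_le0 (J : finType) m (X A : J -> 'M[C]_m) :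
  (forall j, posdefmx (A j)) -> \sum_j rtr (X j) = 0 ->
  (forall s : R, 0 <= s ->
     0 <= \sum_j rtr (X j *m invmx (regularize (A j) s))) ->
  \sum_j rtr (X j *m mxlog (A j)) <= 0.
Proof.
move=> pA X0 dX; have hA j := posmx_adj (posdef_posmx (pA j)).
have /fin_all_exists[dw dwP] : forall j, exists dw : ('I_m -> R) * ('I_m -> R),
    [/\ forall i, 0 < dw.1 i, rtr (X j) = \sum_i dw.2 i &
    forall f, rtr (X j *m fcalc f (A j)) = \sum_i dw.2 i * f (dw.1 i)].
  move=> j; have [d [w [/(_ (pA j)) d0 _ wX fE]]] := rtr_fcalc (X j) (hA j).
  by exists (d, w).
have fE f : \sum_j rtr (X j *m fcalc f (A j)) =
    \sum_(p : J * 'I_m) (dw p.1).2 p.2 * f ((dw p.1).1 p.2).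
  rewrite -(pair_bigA _ (fun j i => (dw j).2 i * f ((dw j).1 i))) /=.
  by apply: eq_bigr => j _; have [_ _ ->] := dwP j.
under eq_bigr do rewrite mxlog_fcalc.
rewrite fE; apply: (@sum_ln_le0 _ (fun p => (dw p.1).2 p.2)
                                  (fun p => (dw p.1).1 p.2)).
- by move=> p; have [] := dwP p.1.
- rewrite -(pair_bigA _ (fun j i => (dw j).2 i)) /= -[RHS]X0.
  by apply: eq_bigr => j _; have [_ ->] := dwP j.
- move=> r /[dup] r0 /dX; rewrite -(fE (fun x => (x + r)^-1)).
  under eq_bigr => j _ do
    rewrite (invmx_fcalc (posdefmx_regularize r0 (pA j))) fcalc_regularize//.
  by [].
Qed.

(** Serves the limits at singular matrices: [A] is only positive here, whence the strictly positive
    shifts. *)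
Lemma rtr_ln_antitone m (X A : 'M[C]_m) (s t : R) : posmx A -> 0 < s -> s <= t ->
  (forall r : R, 0 < r -> rtr (X *m invmx (regularize A r)) <= 0) ->
  rtr (X *m mxlog (regularize A t)) <= rtr (X *m mxlog (regularize A s)).
Proof.
move=> pA s0 st dX; have hA := posmx_adj pA.
have [d [w [_ /(_ pA) d0 _ fE]]] := rtr_fcalc X hA.
rewrite 2!mxlog_fcalc.
rewrite (fcalc_regularize _ t hA) (fcalc_regularize _ s hA).
rewrite [leLHS]fE [leRHS]fE.
apply: sum_ln_anti st _ _ => [i|r sr]; first by rewrite ltr_wpDl.
have r0 := lt_le_trans s0 sr.
have := dX r r0; rewrite (invmx_fcalc (posmx_regularize r0 pA)).
by rewrite (fcalc_regularize _ _ hA) fE.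
Qed.

(** Monotonicity of the logarithm tested against [rho]; the weights rho and - rho have total trace
    0, as [rtr_ln_le0] demands. *)
Lemma mxlog_mono m (rho A B : 'M[C]_m) : posmx rho -> posdefmx A ->
  posdefmx B ->
  (forall s : R, 0 <= s ->
    posmx (invmx (regularize A s) - invmx (regularize B s))) ->
  rtr (rho *m mxlog A) <= rtr (rho *m mxlog B).
Proof.
move=> pr pA pB AB.
pose X (b : bool) := if b then rho else - rho.
pose Y (b : bool) := if b then A else B.
have := @rtr_ln_le0 _ _ X Y; rewrite !big_bool /= rtrN subrr mulNmx rtrN.
rewrite subr_le0; apply => [[]||s s0]; [exact: pA|exact: pB|by []|].
rewrite big_bool /= mulNmx -rtrD -mulmxBr.
by apply: rtr_mul_posmx; [exact: pr|exact: AB].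
Qed.

Lemma posmx_diag_ge0 m (A : 'M[C]_m) i : posmx A -> 0 <= complex.Re (A i i).
Proof.
move=> /posmxE/(_ (delta_mx 0 i)).
rewrite adjmxE trmx_delta map_delta_mx -rowE -colE !mxE.
by rewrite lecE => /andP[].
Qed.

(** The convex function x ln x lies above its tangent at [c]; this is ln (c/x) <= c/x - 1. *)
Lemma tangent_xlnx (x c : R) : 0 < x -> 0 < c ->
  0 <= x * ln x + ((- (ln c + 1)) * x + c).
Proof.
move=> x0 c0.
have : ln (c / x) <= c / x - 1.
  have := @le_ln1Dx R (c / x - 1); rewrite [1 + _]addrC subrK; apply.
  by rewrite ltrBrDl subrr divr_gt0.
rewrite ln_div ?posrE// -(ler_pM2l x0) mulrBr mulrBr mulrCA divff ?gt_eqF//.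
by rewrite !mulr1; nra.
Qed.

(** For each eigenvalue e_k of [B], the tangent inequality at e_k is applied to [A] by functional
    calculus and read off at the k-th diagonal entry in the eigenbasis of [B]. Summing over k gives
    the claim, since the traces agree. *)
Lemma klein m (A B : 'M[C]_m) : posdefmx A -> posdefmx B -> rtr A = rtr B ->
  rtr (A *m mxlog B) <= rtr (A *m mxlog A).
Proof.
move=> pA pB AB; have hA := posmx_adj (posdef_posmx pA).
have hB := posmx_adj (posdef_posmx pB).
have [V [e [VV V'V BE fB]]] := spectral_herm hB.
have e0 := spectral_posdefmx VV BE pB.
have conjE X : rtr X = \sum_k complex.Re ((V *m X *m V^H) k k).
  transitivity (rtr (V *m X *m V^H)); last by rewrite rtrE raddf_sum.
  by rewrite rtrC mulmxA V'V mul1mx.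
have AfE f : rtr (A *m fcalc f B) =
    \sum_k complex.Re ((V *m A *m V^H) k k) * f (e k).
  rewrite fB mulmxA rtrC !mulmxA rtrE raddf_sum; apply: eq_bigr => i _.
  rewrite rdiag_diag_mx mul_mx_diag !mxE /=.
  by case: (\sum_j _) => a b; simpc.
rewrite !mxlog_fcalc AfE.
have AlnE : A *m fcalc (@ln R) A = fcalc (fun x => x * ln x) A.
  by rewrite -{1}(fcalc_id hA) fcalcM.
have BtrE : rtr B = \sum_k e k.
  rewrite conjE; apply: eq_bigr => k _.
  by rewrite {1}BE !mulmxA VV mul1mx -mulmxA VV mulmx1 rdiagE eqxx.
have tang k : 0 <= complex.Re ((V *m (A *m fcalc (@ln R) A) *m V^H) k k) -
    (ln (e k) + 1) * complex.Re ((V *m A *m V^H) k k) + e k.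
  have pT : posmx (A *m fcalc (@ln R) A
                   + ((- (ln (e k) + 1))%:C *: A + ((e k)%:C)%:M)).
    rewrite AlnE (fcalc_add_affine _ _ _ hA).
    (* The tangent inequality is only known for positive arguments; truncating at 0 makes the
       function nonnegative everywhere and changes nothing on the spectrum of [A]. *)
    rewrite (@eq_fcalc_posdef _ _ _ (fun x => Num.max 0
      (x * ln x + ((- (ln (e k) + 1)) * x + e k))) A pA); last first.
      by move=> x x0; rewrite max_r// tangent_xlnx.
    by apply: fcalc_posmx_herm => // x; rewrite le_max lexx.
  have := posmx_diag_ge0 k (posmx_conj V pT).
  rewrite !mulmxDr !mulmxDl -scalemxAr -scalemxAl.
  have -> : V *m ((e k)%:C)%:M *m V^H = ((e k)%:C)%:M.
    by rewrite scalar_mxC -mulmxA VV mulmx1.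
  move: (V *m _ *m _) (V *m _ *m _) => P Q.
  rewrite !mxE eqxx mulr1n.
  move: (P k k) (Q k k) => [a b] [a' b']; simpc => /= h.
  by rewrite -addrA.
have : 0 <= \sum_k (complex.Re ((V *m (A *m fcalc (@ln R) A) *m V^H) k k) -
    (ln (e k) + 1) * complex.Re ((V *m A *m V^H) k k) + e k).
  by apply: sumr_ge0 => k _; exact: tang.
rewrite big_split sumrB /= -conjE -BtrE -AB.
under [X in _ - X + _]eq_bigr do rewrite mulrDl mul1r mulrC.
rewrite big_split /= -conjE.
by rewrite opprD addrA subrK subr_ge0.
Qed.

End Comparison.

(** * Commutants, conditional expectations and Fisher information *)

Section OperatorInequalities.
Context {R : realType}.
Local Notation C := R[i].

Lemma rtr_tr m (A : 'M[C]_m) : \tr A = 0 -> rtr A = 0.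
Proof. by rewrite rtrE => ->. Qed.

Lemma posdefmx_adj m (A : 'M[C]_m) : posdefmx A -> A^H = A.
Proof. by move=> /posdef_posmx/posmx_adj. Qed.

Lemma invmx_adj m (A : 'M[C]_m) : posdefmx A -> (invmx A)^H = invmx A.
Proof.
by move=> pA; rewrite (invmx_fcalc pA) fcalc_adj// posdefmx_adj.
Qed.

Lemma invmx_posmx m (A : 'M[C]_m) : posdefmx A -> posmx (invmx A).
Proof.
move=> pA; rewrite (invmx_fcalc pA); apply: fcalc_posmx.
  exact: posdef_posmx.
by move=> x x0; rewrite invr_ge0.
Qed.

Lemma invmx_scale m (c : R) (A : 'M[C]_m) : 0 < c -> A \in unitmx ->
  invmx (c%:C *: A) = (c^-1)%:C *: invmx A.
Proof.
move=> c0 uA; apply: invmx_uniq; rewrite -scalemxAl -scalemxAr scalerA mulmxV//.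
by rewrite -rmorphM mulfV ?gt_eqF// scale1r.
Qed.

(** With D = A^-1 - B^-1 one has D = D A D + B^-1 (B - A) B^-1, a sum of two positive matrices. *)
Lemma invmx_antitone m (A B : 'M[C]_m) : posdefmx A -> posdefmx B ->
  posmx (B - A) -> posmx (invmx A - invmx B).
Proof.
move=> pA pB AB; have uA := posdefmx_unit pA; have uB := posdefmx_unit pB.
have hA := invmx_adj pA; have hB := invmx_adj pB.
have -> : invmx A - invmx B =
    (invmx A - invmx B) *m A *m (invmx A - invmx B)
    + invmx B *m (B - A) *m invmx B.
  rewrite !mulmxBr !mulmxBl mulVmx// mul1mx mulVmx// mul1mx.
  rewrite -(mulmxA (invmx B) A) mulmxV// mulmx1.
  by rewrite subrK.
apply: posmxD.
  rewrite -{2}hA -{2}hB -adjB; apply: posmx_conj; exact: posdef_posmx.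
by rewrite -{2}hB; exact: posmx_conj.
Qed.

(** The factors are exchanged one at a time; each difference is the trace of a product of two
    positive matrices. *)
Lemma rtr_sandwich_mono m n (y : 'M[C]_(m, n)) (S T : 'M[C]_m)
    (S' T' : 'M[C]_n) : posmx S -> posmx T' ->
  posmx (T - S) -> posmx (T' - S') ->
  rtr (y *m S' *m y^H *m S) <= rtr (y *m T' *m y^H *m T).
Proof.
move=> pS pT' ST ST'; rewrite -subr_ge0.
have -> : rtr (y *m T' *m y^H *m T) - rtr (y *m S' *m y^H *m S) =
    rtr (y *m T' *m y^H *m (T - S)) + rtr (y *m (T' - S') *m y^H *m S).
  by rewrite mulmxBr rtrB mulmxBr !mulmxBl rtrB addrA subrK.
by apply: addr_ge0; apply: rtr_mul_posmx; [exact: posmx_conj|exact: ST|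
  exact: posmx_conj|exact: pS].
Qed.

Definition commutator m (b x : 'M[C]_m) := b *m x - x *m b.

Lemma commutatorB m (b x y : 'M[C]_m) :
  commutator b (x - y) = commutator b x - commutator b y.
Proof.
rewrite /commutator mulmxBr mulmxBl !opprB addrACA [RHS]addrACA.
by congr (_ + _); exact: addrC.
Qed.

Lemma commutator_adj m (b x : 'M[C]_m) : b^H = b -> x^H = x ->
  (commutator b x)^H = - commutator b x.
Proof. by move=> hb hx; rewrite adjB !adjM hb hx opprB. Qed.

Section Commutant.
Variables (m k : nat) (b : 'I_k -> 'M[C]_m).
Hypothesis hb : forall j, (b j)^H = b j.

Definition commutes (y : 'M[C]_m) : Prop := forall j, y *m b j = b j *m y.

(** Orthogonality is bilinear, without adjoint: the commutant of Hermitian matrices is closed under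
    adjoints, so this is orthogonality for the trace inner product. The relational form suits every
    ampliation. *)
Definition is_condexp (x z : 'M[C]_m) : Prop :=
  commutes z /\ forall y, commutes y -> \tr ((x - z) *m y) = 0.

Lemma commutes_adj y : commutes y -> commutes y^H.
Proof. by move=> cy j; rewrite -(hb j) -!adjM cy. Qed.

Lemma commutesD x y : commutes x -> commutes y -> commutes (x + y).
Proof. by move=> cx cy j; rewrite mulmxDl cx cy mulmxDr. Qed.

Lemma commutesN x : commutes x -> commutes (- x).
Proof. by move=> cx j; rewrite mulNmx cx mulmxN. Qed.

Lemma commutes_scalar c : commutes c%:M.
Proof. by move=> j; rewrite scalar_mxC. Qed.

Lemma commutes_fcalc f y : y^H = y -> commutes y -> commutes (fcalc f y).
Proof. by move=> hy cy j; exact: fcalc_comm. Qed.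

Lemma commutes_invmx y : y \in unitmx -> commutes y -> commutes (invmx y).
Proof.
move=> uy cy j.
by rewrite -[LHS](mulmxK uy) -(mulmxA (invmx y)) -cy mulKmx.
Qed.

Lemma commutes_regularize y s : commutes y -> commutes (regularize y s).
Proof. by move=> cy; apply: commutesD => //; exact: commutes_scalar. Qed.

Lemma commutes_orth_eq0 y : commutes y ->
  (forall z, commutes z -> \tr (y *m z) = 0) -> y = 0.
Proof.
by move=> /commutes_adj cy /(_ _ cy)/rtr_tr/rtr_gram_eq0.
Qed.

Lemma condexp_uniq x z z' : is_condexp x z -> is_condexp x z' -> z = z'.
Proof.
move=> [cz xz] [cz' xz']; apply/eqP; rewrite -subr_eq0; apply/eqP.
apply: commutes_orth_eq0; first by apply: commutesD => //; exact: commutesN.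
move=> y cy; have -> : z - z' = (x - z') - (x - z).
  by rewrite opprB addrCA addrAC subrr add0r addrC.
by rewrite mulmxBl linearB /= xz'// xz// subrr.
Qed.

Lemma condexp_adj x z : is_condexp x z -> is_condexp x^H z^H.
Proof.
move=> [cz xz]; split; first exact: commutes_adj.
move=> y /commutes_adj cy.
rewrite -adjB -[y]adjK -adjM tr_adj mxtrace_mulC xz// rmorph0//.
Qed.

Lemma condexp_herm x z : x^H = x -> is_condexp x z -> z^H = z.
Proof.
by move=> hx xz; apply: (@condexp_uniq x) => //; rewrite -{1}hx; exact: condexp_adj.
Qed.

Lemma condexp_sum (I : finType) (F G : I -> 'M[C]_m) :
  (forall i, is_condexp (F i) (G i)) -> is_condexp (\sum_i F i) (\sum_i G i).
Proof.
move=> FG; split.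
  by move=> j; rewrite mulmx_suml mulmx_sumr; apply: eq_bigr => i _; have [->] := FG i.
move=> y cy; rewrite -sumrB mulmx_suml linear_sum big1// => i _ /=.
by have [_ ->] := FG i.
Qed.

Lemma condexp_regularize x z s : is_condexp x z ->
  is_condexp (regularize x s) (regularize z s).
Proof.
move=> [cz xz]; split; first exact: commutes_regularize.
by move=> y cy; rewrite /regularize opprD addrACA subrr addr0 xz.
Qed.

Lemma condexp_rtr x z y : is_condexp x z -> commutes y ->
  rtr (x *m y) = rtr (z *m y).
Proof.
move=> [_ xz] cy; apply/eqP; rewrite -subr_eq0 -rtrB -mulmxBl.
by rewrite rtr_tr// xz.
Qed.

(** The negative part n of [z] lies in the commutant, hence tr (z n) = tr (x n) >= 0; but z n = -
    n^2, so n = 0. *)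
Lemma condexp_pos x z : posmx x -> is_condexp x z -> posmx z.
Proof.
move=> px xz; have hz := condexp_herm (posmx_adj px) xz.
have [cz _] := xz; pose n := fcalc (fun t : R => Num.max 0 (- t)) z.
have cn : commutes n by exact: commutes_fcalc.
have pn : posmx n by apply: fcalc_posmx_herm => // t; rewrite le_max lexx.
have hn := posmx_adj pn.
have n0 : n = 0.
  apply: rtr_gram_eq0; apply/eqP; rewrite eq_le rtr_gram_ge0 andbT -oppr_ge0.
  rewrite hn -rtrN -mulNmx.
  suff -> : - n *m n = z *m n by rewrite -(condexp_rtr xz cn) rtr_mul_posmx.
  have := fcalcM id (fun t : R => Num.max 0 (- t)) hz.
  rewrite (fcalc_id hz) -/n => ->.
  rewrite mulNmx (fcalcM _ _ hz); apply/eqP; rewrite eq_sym -addr_eq0.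
  rewrite (fcalcD _ _ hz) (_ : (fun _ => _) = fun=> 0); last first.
    apply/funext => t; case: (lerP 0 (- t)) => t0.
      by rewrite mulrNN mulrN subrr || rewrite mulrNN mulrN addrC subrr.
    by rewrite !mulr0 addr0.
  by rewrite (fcalc_cst _ hz) raddf0.
have -> : z = fcalc (fun t : R => t + Num.max 0 (- t)) z.
  have := fcalcD id (fun t : R => Num.max 0 (- t)) hz.
  by rewrite (fcalc_id hz) -/n n0 addr0.
apply: fcalc_posmx_herm => // t.
by case: (lerP 0 (- t)) => t0; [rewrite subrr|rewrite addr0; rewrite oppr_lt0 in t0; exact: ltW].
Qed.

(** L(x) is the sum of the double commutators [b_j, [b_j, x]], and tr ([b, w] y) = - tr (w
    [b, y]). *)
Lemma tr_lindblad x y : \tr (lindblad b x *m y) =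
  - \sum_j \tr (commutator (b j) x *m commutator (b j) y).
Proof.
rewrite /lindblad mulmx_suml linear_sum /= -sumrN; apply: eq_bigr => j _.
rewrite /commutator.
have -> : b j *m b j *m x + x *m (b j *m b j) - 2%:R *: (b j *m x *m b j) =
    b j *m (b j *m x - x *m b j) - (b j *m x - x *m b j) *m b j.
  rewrite mulmxBr mulmxBl !mulmxA scaler_nat mulr2n !opprD opprK.
  by rewrite addrACA; congr (_ + _); exact: addrC.
move: (b j *m x - x *m b j) => w.
rewrite mulmxBl raddfB mulmxBr /= raddfB /= opprB !mulmxA.
by rewrite -(mulmxA (b j)) (mxtrace_mulC (b j)).
Qed.

Lemma rtr_lindblad x y : rtr (lindblad b x *m y) =
  - \sum_j rtr (commutator (b j) x *m commutator (b j) y).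
Proof.
rewrite !rtrE tr_lindblad raddfN raddf_sum; congr (- _).
by apply: eq_bigr => j _; rewrite rtrE.
Qed.

(** A derivation acts on inverses by [b, y^-1] = - y^-1 [b, y] y^-1. This sign cancels that of
    [b, x]^H = - [b, x], and the shift by [s] is central. *)
Lemma fisher_information x s : x^H = x -> posdefmx (regularize x s) ->
  rtr (lindblad b x *m invmx (regularize x s)) =
  - \sum_j rtr (commutator (b j) x *m invmx (regularize x s)
                *m (commutator (b j) x)^H *m invmx (regularize x s)).
Proof.
move=> hx pxs; rewrite rtr_lindblad; congr (- _); apply: eq_bigr => j _.
rewrite commutator_adj// -!mulmxA; congr (rtr (_ *m _)).
have uxs := posdefmx_unit pxs.
have -> : commutator (b j) x = commutator (b j) (regularize x s).
  by rewrite /commutator mulmxDl mulmxDr scalar_mxC opprD addrACA subrr addr0.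
rewrite /commutator; move: (regularize x s) uxs => y uy.
by rewrite mulNmx mulmxN mulmxBl mulmxBr !mulmxA mulVmx// mul1mx -!mulmxA
  mulmxV// mulmx1 opprB.
Qed.

Lemma rtr_lindblad_le0 x s : x^H = x -> posdefmx (regularize x s) ->
  rtr (lindblad b x *m invmx (regularize x s)) <= 0.
Proof.
move=> hx pxs; rewrite fisher_information// oppr_le0 sumr_ge0// => j _.
by rewrite rtr_mul_posmx//; [apply: posmx_conj|]; exact: invmx_posmx.
Qed.

Lemma lindblad_tr x : rtr (lindblad b x) = 0.
Proof.
rewrite -[lindblad b x]mulmx1 rtr_lindblad big1 ?oppr0// => j _.
by rewrite /commutator mulmx1 mul1mx subrr mulmx0 rtr0.
Qed.

(** A Poincare inequality for all [z], Hermitian or not, because it is later applied to the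
    off-diagonal blocks of an ampliation. *)
Definition spectral_gap (g : R) := forall z,
  (forall y, commutes y -> \tr (z *m y) = 0) ->
  g * rtr (z *m z^H) <=
  \sum_j rtr (commutator (b j) z *m (commutator (b j) z)^H).

(** Apply the gap to T x T with T the square root of [S]: as T commutes with the b_j, it passes
    through the commutators and preserves orthogonality to the commutant. *)
Lemma weighted_gap g x S : spectral_gap g -> posmx S -> commutes S ->
  (forall y, commutes y -> \tr (x *m y) = 0) ->
  g * rtr (x *m S *m x^H *m S) <=
  \sum_j rtr (commutator (b j) x *m S *m (commutator (b j) x)^H *m S).
Proof.
move=> gap pS cS ox; have [T [hT ST cT]] := posmx_sqrt pS.
have {}cT j : T *m b j = b j *m T by apply: cT.
have TT X : rtr ((T *m X *m T) *m (T *m X *m T)^H) = rtr (X *m S *m X^H *m S).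
  by rewrite !adjM hT ST [RHS]rtrC !mulmxA rtrC !mulmxA.
have := gap (T *m x *m T); rewrite TT => /(_ _)/le_trans; apply.
  move=> y cy; rewrite -!mulmxA mxtrace_mulC -!mulmxA ox// => j.
  by rewrite -!mulmxA cT (mulmxA y) cy !mulmxA cT.
apply: ler_sum => j _; rewrite -TT.
suff -> : commutator (b j) (T *m x *m T) = T *m commutator (b j) x *m T by [].
by rewrite /commutator mulmxBr mulmxBl !mulmxA cT -!mulmxA cT.
Qed.

End Commutant.
End OperatorInequalities.

(** * The relative entropy is bounded by the Fisher information *)

Section LogSobolev.
Context {R : realType}.
Local Notation C := R[i].
Variables (m k : nat) (b : 'I_k -> 'M[C]_m).
Hypothesis hb : forall j, (b j)^H = b j.

Lemma commutator_commutes x y j : commutes b y ->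
  commutator (b j) (x - y) = commutator (b j) x.
Proof.
by move=> cy; rewrite commutatorB [X in _ - X]/commutator cy subrr subr0.
Qed.

(** The relation t A <= B survives a shift because t <= 1: the excess is (1 - t) s. *)
Lemma resolvent_antitone (t s : R) (A B : 'M[C]_m) :
  0 < t -> t <= 1 -> 0 <= s -> posdefmx A -> posdefmx B ->
  posmx (B - t%:C *: A) ->
  posmx ((t^-1)%:C *: invmx (regularize A s) - invmx (regularize B s)).
Proof.
move=> t0 t1 s0 pA pB AB.
have pAs := posdefmx_regularize s0 pA.
rewrite -(invmx_scale t0 (posdefmx_unit pAs)); apply: invmx_antitone.
- exact: posdefmxZ.
- exact: posdefmx_regularize.
have -> : regularize B s - t%:C *: regularize A s =
    (B - t%:C *: A) + (((1 - t) * s)%:C)%:M.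
  rewrite /regularize scalerDr opprD addrACA; congr (_ + _).
  apply/matrixP => i j; rewrite !mxE rmorphM rmorphB rmorph1 mulrBl mul1r.
  by rewrite mulrnBl mulrnAr.
by apply: posmxD; [exact: AB|apply: posmx_scalar; rewrite mulr_ge0 ?subr_ge0].
Qed.

Lemma rtr_sandwich_le (c : R) (x S P Q : 'M[C]_m) : 0 <= c ->
  posmx S -> posmx P -> posmx Q -> posmx (c%:C *: S - P) -> posmx (S - Q) ->
  rtr (x *m P *m x^H *m Q) <= c * rtr (x *m S *m x^H *m S).
Proof.
move=> c0 pS pP pQ SP SQ; rewrite -rtrZ scalemxAl scalemxAl scalemxAr.
by apply: rtr_sandwich_mono; [exact: pQ|exact: posmxZ|exact: SQ|exact: SP].
Qed.

Lemma rtr_sandwich_ge (c : R) (x S T : 'M[C]_m) : 0 <= c ->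
  posmx S -> posmx T -> posmx (c%:C *: T - S) ->
  rtr (x *m S *m x^H *m S) <= c ^+ 2 * rtr (x *m T *m x^H *m T).
Proof.
move=> c0 pS pT TS; rewrite expr2 -mulrA -!rtrZ.
rewrite scalemxAr scalemxAl scalemxAl scalemxAr.
by apply: rtr_sandwich_mono; [exact: pS|exact: posmxZ|exact: TS|exact: TS].
Qed.

Lemma invmxB (A B : 'M[C]_m) : A \in unitmx -> B \in unitmx ->
  invmx A - invmx B = invmx A *m (B - A) *m invmx B.
Proof.
by move=> uA uB; rewrite mulmxBr mulmxBl -mulmxA mulmxV// mulmx1 mulVmx// mul1mx.
Qed.

(** Here S, T, Q, P stand for the resolvents of sigma, rho, B and B + x/2, and y_j for [b_j, x]. The
    step length 1/2 pays for P <= 2 S; replacing both copies of S by c T yields c^2. *)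
Lemma resolvent_core (g c : R) (x S P Q T : 'M[C]_m) (y : 'I_k -> 'M[C]_m) :
  0 < g -> 0 <= c -> x^H = x ->
  posmx S -> posmx P -> posmx Q -> posmx T ->
  g * rtr (x *m S *m x^H *m S) <= \sum_j rtr (y j *m S *m (y j)^H *m S) ->
  posmx (c%:C *: T - S) -> posmx (S - Q) -> posmx (2%:C *: S - P) ->
  rtr (x *m (Q *m ((2^-1)%:C *: x) *m P)) <=
  c ^+ 2 / g * \sum_j rtr (y j *m T *m (y j)^H *m T).
Proof.
move=> g0 c0 hx pS pP pQ pT gap TS SQ SP.
have -> : rtr (x *m (Q *m ((2^-1)%:C *: x) *m P)) =
    2^-1 * rtr (x *m P *m x^H *m Q).
  rewrite hx -scalemxAr -scalemxAl -scalemxAr rtrZ; congr (_ * _).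
  by rewrite !mulmxA -(mulmxA _ x P) rtrC !mulmxA.
apply: (@le_trans _ _ (rtr (x *m S *m x^H *m S))).
  by rewrite mulrC ler_pdivrMr// mulrC (rtr_sandwich_le x (ler0n _ 2) pS pP pQ SP SQ).
rewrite -(ler_pM2l g0) mulrA mulrCA divff ?gt_eqF// mulr1.
apply: (le_trans gap); rewrite mulr_sumr; apply: ler_sum => j _.
exact: rtr_sandwich_ge _ c0 pS pT TS.
Qed.

(* The resolvents of B, B + x/2 and rho are all controlled by that of sigma,
   and the latter commutes with the b_j, so that the spectral gap applies. *)
Lemma half_step_resolvent (g c s : R) (rho sigma B : 'M[C]_m) :
  0 < g -> 1 <= c -> 0 <= s -> spectral_gap b g ->
  posdefmx rho -> posdefmx sigma ->
  is_condexp b rho sigma -> posmx (sigma - (c^-1)%:C *: rho) -> posdefmx B ->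
  posdefmx (B + (2^-1)%:C *: (rho - sigma)) ->
  posmx (B - sigma) ->
  posmx (B + (2^-1)%:C *: (rho - sigma) - (2^-1)%:C *: sigma) ->
  rtr ((rho - sigma) *m invmx (regularize B s))
  - rtr ((rho - sigma) *m
         invmx (regularize (B + (2^-1)%:C *: (rho - sigma)) s)) <=
  c ^+ 2 / g * - rtr (lindblad b rho *m invmx (regularize rho s)).
Proof.
move=> g0 c1 s0 gap pr ps [csig ox] rs pB.
have hx : (rho - sigma)^H = rho - sigma.
  by rewrite adjB (posdefmx_adj pr) (posdefmx_adj ps).
have comE j : commutator (b j) rho = commutator (b j) (rho - sigma).
  by rewrite (commutator_commutes _ _ csig).
set B' := B + _ => pB' Bs B's.
have c0 : 0 < c by rewrite (lt_le_trans ltr01).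
have prs := posdefmx_regularize s0 pr; have pss := posdefmx_regularize s0 ps.
have pBs := posdefmx_regularize s0 pB; have pB's := posdefmx_regularize s0 pB'.
rewrite (fisher_information hb (posdefmx_adj pr) prs) opprK -rtrB -mulmxBr.
(* The resolvent identity turns the difference into a product with x/2 in the middle. *)
rewrite (invmxB (posdefmx_unit pBs) (posdefmx_unit pB's)).
have -> : regularize B' s - regularize B s = (2^-1)%:C *: (rho - sigma).
  by rewrite /regularize /B' opprD addrACA subrr addr0 [B + _]addrC addrK.
have rho_res : posmx (c%:C *: invmx (regularize rho s) - invmx (regularize sigma s)).
  have := @resolvent_antitone c^-1 s rho sigma; rewrite invrK; apply.
  - by rewrite invr_gt0.
  - by rewrite invf_le1.
  - exact: s0.
  - exact: pr.
  - exact: ps.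
  - exact: rs.
have B_res : posmx (invmx (regularize sigma s) - invmx (regularize B s)).
  have := @resolvent_antitone 1 s sigma B ltr01 (lexx _) s0 ps pB.
  by rewrite invr1 !scale1r; move=> /(_ Bs).
have B'_res : posmx (2%:C *: invmx (regularize sigma s) - invmx (regularize B' s)).
  have h0 : 0 < 2^-1 :> R by rewrite invr_gt0.
  have h1 : 2^-1 <= 1 :> R by rewrite invf_le1// ler1n.
  by have := resolvent_antitone h0 h1 s0 ps pB' B's; rewrite invrK.
have gapx := weighted_gap gap (invmx_posmx pss)
  (commutes_invmx (posdefmx_unit pss) (commutes_regularize s csig)) ox.
under eq_bigr => j _ do rewrite comE.
exact: (resolvent_core g0 (ltW c0) hx (invmx_posmx pss) (invmx_posmx pB's)
  (invmx_posmx pBs) (invmx_posmx prs) gapx rho_res B_res B'_res).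
Qed.

Lemma half_step (g c : R) (rho sigma B : 'M[C]_m) :
  0 < g -> 1 <= c -> spectral_gap b g -> posdefmx rho -> posdefmx sigma ->
  is_condexp b rho sigma -> posmx (sigma - (c^-1)%:C *: rho) -> posdefmx B ->
  posdefmx (B + (2^-1)%:C *: (rho - sigma)) ->
  posmx (B - sigma) ->
  posmx (B + (2^-1)%:C *: (rho - sigma) - (2^-1)%:C *: sigma) ->
  rtr ((rho - sigma) *m mxlog (B + (2^-1)%:C *: (rho - sigma)))
  - rtr ((rho - sigma) *m mxlog B) <=
  c ^+ 2 / g * rtr (lindblad b rho *m mxlog rho).
Proof.
move=> g0 c1 gap pr ps cs rs pB pB' Bs B's.
have H s (s0 : 0 <= s) := half_step_resolvent g0 c1 s0 gap pr ps cs rs pB pB' Bs B's.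
move: (lindblad_tr b rho) pB' H {Bs B's rs cs ps}.
move: (rho - sigma) (B + _) (c ^+ 2 / g) (lindblad b rho) => x B' K Lr.
move=> trL pB' H.
(* The three weights have total trace 0 since L(rho) is traceless, so the resolvent inequality
   passes to the logarithms. *)
pose X (i : 'I_3) := if i == 0 then x else if i == 1 then - x else (- K)%:C *: Lr.
pose A (i : 'I_3) := if i == 0 then B' else if i == 1 then B else rho.
have big3 (F : 'I_3 -> R) : \sum_i F i = F 0 + F 1 + F (1 + 1).
  rewrite !big_ord_recl big_ord0 addr0 addrA; congr (F _ + F _ + F _);
  exact/val_inj.
have := @rtr_ln_le0 _ _ _ X A; rewrite !big3 /X /A /= mulNmx !rtrN.
rewrite -scalemxAl !rtrZ !mulNr subr_le0; apply => [i||s s0].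
- by case: ifP => _; [exact: pB'|case: ifP => _; [exact: pB|exact: pr]].
- by rewrite subrr add0r trL mulr0 oppr0.
rewrite big3 /= mulNmx rtrN -scalemxAl rtrZ mulNr.
by have := H s s0; rewrite -subr_ge0 mulrN opprB [X in 0 <= X -> _]addrC addrAC.
Qed.

End LogSobolev.

Local Opaque mxlog.

(** * Telescoping along the dyadic points of the segment *)

Section Telescoping.
Context {R : realType}.
Local Notation C := R[i].
Variables (m k : nat) (b : 'I_k -> 'M[C]_m).
Hypothesis hb : forall j, (b j)^H = b j.

Lemma mxlog_scale (c : R) (A : 'M[C]_m) : 0 < c -> posdefmx A ->
  mxlog (c%:C *: A) = mxlog A + ((ln c)%:C)%:M.
Proof.
move=> c0 pA; have hA := posdefmx_adj pA.
have := fcalc_affine (@ln R) c 0 hA.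
rewrite raddf0 addr0 -mxlog_fcalc => ->.
rewrite mxlog_fcalc -(fcalc_cst (ln c) hA) (fcalcD _ _ hA).
by apply: eq_fcalc_posdef => // x x0; rewrite addr0 lnM ?posrE// addrC.
Qed.

Lemma rtr_mxlog_scale (x : 'M[C]_m) (c : R) (A : 'M[C]_m) : rtr x = 0 ->
  0 < c -> posdefmx A -> rtr (x *m mxlog (c%:C *: A)) = rtr (x *m mxlog A).
Proof.
move=> x0 c0 pA; rewrite (mxlog_scale c0 pA) mulmxDr rtrD scalar_mxC.
by rewrite mul_scalar_mx rtrZ x0 mulr0 addr0.
Qed.

Definition segment (rho sigma : 'M[C]_m) (e : R) : 'M[C]_m :=
  (1 - e)%:C *: rho + e%:C *: sigma.

Lemma segment1 rho sigma : segment rho sigma 1 = sigma.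
Proof.
apply/matrixP => i j.
by rewrite /segment !mxE rmorphB subrr rmorph1 mul0r add0r mul1r.
Qed.

Lemma segment_posdef rho sigma e : posdefmx rho -> posdefmx sigma ->
  0 < e -> e <= 1 -> posdefmx (segment rho sigma e).
Proof.
move=> pr ps e0 e1; rewrite /segment addrC; apply: posdefmxD.
  exact: posdefmxZ.
by apply: posmxZ; [rewrite subr_ge0|exact: posdef_posmx].
Qed.

Fact segment_step_arith (e K x x' t t' : R) : 0 <= e ->
  x' - x <= K -> t' <= t -> (t' + e * x') - (t + e * x) <= e * K.
Proof. by move=> e0 hx ht; have := ler_wpM2l e0 hx; lra. Qed.

(** Split rho as S_e + e x, with S_e the point of parameter [e]. Against S_e the difference of
    logarithms is nonpositive by Klein's inequality; against x it is a half step, which thus enters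
    with weight e. *)
Lemma segment_step (g c e : R) (rho sigma : 'M[C]_m) :
  0 < g -> 1 <= c -> spectral_gap b g -> posdefmx rho -> posdefmx sigma ->
  is_condexp b rho sigma -> posmx (sigma - (c^-1)%:C *: rho) ->
  0 < e -> e <= 1 ->
  rtr (rho *m mxlog (segment rho sigma (e / 2)))
  - rtr (rho *m mxlog (segment rho sigma e)) <=
  e * (c ^+ 2 / g * rtr (lindblad b rho *m mxlog rho)).
Proof.
move=> g0 c1 gap pr ps cs rs e0 e1.
have trx : rtr (rho - sigma) = 0.
  have [_ ox] := cs; rewrite -[_ - _]mulmx1; apply/rtr_tr/ox.
  exact: commutes_scalar.
have e2 : 0 < e / 2 by rewrite divr_gt0.
have e21 : e / 2 <= 1 by rewrite ler_pdivrMr// mul1r (le_trans e1)// ler1n.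
have pt := segment_posdef pr ps e0 e1; have pt' := segment_posdef pr ps e2 e21.
have ei1 : 0 <= e^-1 - 1 by rewrite subr_ge0 invf_ge1.
(* Chosen so that S_e = e B and S_(e/2) = e (B + x/2). Moreover B + x/2 - sigma/2 = (1/e - 1/2) rho
   is positive. *)
pose B := sigma + (e^-1 - 1)%:C *: rho.
have e0' : e%:C != 0 :> C by rewrite (fmorph_eq0 (real_complex R)) gt_eqF.
have segB : segment rho sigma e = e%:C *: B.
  rewrite /segment /B scalerDr scalerA -rmorphM addrC.
  by rewrite mulrBr mulr1 mulfV ?gt_eqF.
have segB' : segment rho sigma (e / 2) =
    e%:C *: (B + (2^-1)%:C *: (rho - sigma)).
  apply/matrixP => i j; rewrite /segment /B !mxE !rmorphB rmorphM !fmorphV.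
  by rewrite rmorph1 rmorph_nat; field.
have unscale A : posdefmx (e%:C *: A) -> posdefmx A.
  move=> pA; have -> : A = (e^-1)%:C *: (e%:C *: A).
    by rewrite scalerA -rmorphM mulVf ?gt_eqF// scale1r.
  by apply: posdefmxZ => //; rewrite invr_gt0.
have pB : posdefmx B by apply: unscale; rewrite -segB.
have pB' : posdefmx (B + (2^-1)%:C *: (rho - sigma)).
  by apply: unscale; rewrite -segB'.
have half : rtr ((rho - sigma) *m mxlog (segment rho sigma (e / 2)))
    - rtr ((rho - sigma) *m mxlog (segment rho sigma e)) <=
    c ^+ 2 / g * rtr (lindblad b rho *m mxlog rho).
  rewrite segB segB'.
  rewrite [X in X - _ <= _](rtr_mxlog_scale trx e0 pB').
  rewrite [X in _ - X <= _](rtr_mxlog_scale trx e0 pB).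
  apply: (half_step hb g0 c1 gap pr ps cs rs pB pB').
  - rewrite /B addrAC subrr add0r; apply: posmxZ => //; exact: posdef_posmx.
  - have -> : B + (2^-1)%:C *: (rho - sigma) - (2^-1)%:C *: sigma =
        (e^-1 - 2^-1)%:C *: rho.
      rewrite /B; apply/matrixP => i j; rewrite !mxE !rmorphB !fmorphV.
      by rewrite rmorph1 rmorph_nat; field.
    apply: posmxZ; last exact: posdef_posmx.
    by rewrite subr_ge0 lef_pV2 ?posrE ?ltr0n// (le_trans e1)// ler1n.
have kl : rtr (segment rho sigma e *m mxlog (segment rho sigma (e / 2))) <=
    rtr (segment rho sigma e *m mxlog (segment rho sigma e)).
  apply: klein; [exact: pt|exact: pt'|rewrite /segment !rtrD !rtrZ].
  by move: trx; rewrite rtrB => /eqP; rewrite subr_eq0 => /eqP->; ring.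
have rhoE : rho = segment rho sigma e + e%:C *: (rho - sigma).
  by apply/matrixP => i j; rewrite /segment !mxE rmorphB rmorph1; ring.
have split A : rtr (rho *m A) =
    rtr (segment rho sigma e *m A) + e * rtr ((rho - sigma) *m A).
  by rewrite {1}rhoE mulmxDl -scalemxAl rtrD rtrZ.
rewrite [X in X - _ <= _]split [X in _ - X <= _]split.
exact: segment_step_arith (ltW e0) half kl.
Qed.

Lemma le_of_le_add_expn (x y M : R) :
  (forall n, x <= y + 2^-1 ^+ n.+1 * M) -> x <= y.
Proof.
move=> H; rewrite leNgt; apply/negP => xy.
have [M0|M0] := lerP M 0.
  by have := H 0; rewrite expr1; lra.
pose n := Num.bound (M / (x - y)).
have d0 : 0 < x - y by rewrite subr_gt0.
have Hn : M / (x - y) < n%:R.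
  by apply: le_lt_trans (archi_boundP _); rewrite ?ler_norm ?divr_ge0// ltW.
have := H n; rewrite leNgt => /negP; apply.
rewrite addrC -ltrBrDr exprVn mulrC ltr_pdivrMr ?exprn_gt0//.
rewrite ltr_pdivrMr// in Hn; rewrite (lt_trans Hn)// mulrC ltr_pM2l//.
by rewrite -natrX ltr_nat (ltn_trans (ltnSn n))// ltn_expl.
Qed.

Fact ln_1B_bound (e : R) : 0 <= e -> e <= 2^-1 -> - ln (1 - e) <= 2 * e.
Proof.
move=> e0 e1; have e1' : 0 < 1 - e by lra.
rewrite -lnV ?posrE//; have := @le_ln1Dx R ((1 - e)^-1 - 1).
rewrite [1 + (_^-1 - 1)]addrC subrK => /(_ _)/le_trans; apply.
  by rewrite ltrBrDl subrr invr_gt0.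
by rewrite lerBlDr -div1r ler_pdivrMr//; nra.
Qed.

Fact telescope_arith (x1 x2 x3 e K : R) : x1 - x2 <= e * K ->
  x2 - x3 <= 2 * (1 - e) * K -> x1 - x3 <= 2 * (1 - e / 2) * K.
Proof. by lra. Qed.

Fact endpoint_arith (x1 x2 x3 l e t K : R) : x1 + l * t <= x2 ->
  x2 - x3 <= 2 * (1 - e) * K -> - l * t <= 2 * e * t ->
  x1 - x3 <= 2 * K + e * (2 * t - 2 * K).
Proof. by move=> h1 h2 h3; lra. Qed.

(** The endpoint rho is never reached. Continuity of the logarithm is replaced by (1 - e) rho <= S_e
    and monotonicity, at the price of - ln (1 - e) tr rho <= 2 e tr rho. *)
Lemma entropy_le_fisher (g c : R) (rho sigma : 'M[C]_m) :
  0 < g -> 1 <= c -> spectral_gap b g -> posdefmx rho -> posdefmx sigma ->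
  is_condexp b rho sigma -> posmx (sigma - (c^-1)%:C *: rho) ->
  rtr (rho *m mxlog rho) - rtr (rho *m mxlog sigma) <=
  2 * (c ^+ 2 / g * rtr (lindblad b rho *m mxlog rho)).
Proof.
move=> g0 c1 gap pr ps cs rs.
set K := c ^+ 2 / g * _.
have tele n : rtr (rho *m mxlog (segment rho sigma (2^-1 ^+ n)))
    - rtr (rho *m mxlog sigma) <= 2 * (1 - 2^-1 ^+ n) * K.
  elim: n => [|n IH].
    by rewrite expr0 segment1 !subrr mulr0 mul0r.
  have e0 : 0 < 2^-1 ^+ n :> R by rewrite exprn_gt0.
  have e1 : 2^-1 ^+ n <= 1 :> R by rewrite exprn_ile1// invf_le1// ler1n.
  have := segment_step g0 c1 gap pr ps cs rs e0 e1; rewrite -/K => st.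
  rewrite exprS mulrC; exact: telescope_arith st IH.
(* 2 tr rho is the loss at the endpoint and - 2 K the missing tail of the geometric sum, both per
   unit of e. The exponent n + 1 ensures e <= 1/2 in [ln_1B_bound]. *)
apply: (@le_of_le_add_expn _ _ (2 * rtr rho - 2 * K)) => n.
pose e : R := 2^-1 ^+ n.+1.
have e0 : 0 < e by rewrite exprn_gt0.
have e1 : e <= 2^-1 by rewrite /e exprS ler_piMr// exprn_ile1// invf_le1// ler1n.
have ele1 : e <= 1 by lra.
have e1' : 0 < 1 - e by lra.
have pseg := segment_posdef pr ps e0 ele1.
have mono : rtr (rho *m mxlog ((1 - e)%:C *: rho)) <=
    rtr (rho *m mxlog (segment rho sigma e)).
  apply: mxlog_mono; [exact: posdef_posmx|exact: posdefmxZ|exact: pseg|].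
  move=> s s0; have pe := posdefmxZ e1' pr.
  have := resolvent_antitone ltr01 (lexx _) s0 pe pseg.
  rewrite invr1 !scale1r; apply; rewrite /segment addrAC subrr add0r.
  by apply: posmxZ; [exact: ltW|exact: posdef_posmx].
have lnb := ln_1B_bound (ltW e0) e1.
have trr : 0 <= rtr rho.
  rewrite -[rho]mulmx1; apply: rtr_mul_posmx; [exact: posdef_posmx|exact: posmx1].
move: mono; rewrite (mxlog_scale e1' pr) mulmxDr rtrD scalar_mxC mul_scalar_mx.
rewrite rtrZ => mono; exact: endpoint_arith mono (tele n.+1) (ler_wpM2r trr lnb).
Qed.

End Telescoping.

(** * Uniformity in the ampliation *)

Section Blocks.
Context {R : realType}.
Local Notation C := R[i].

Lemma sum_mxtens (V : nmodType) n l (F : 'I_(n * l) -> V) :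
  \sum_k F k = \sum_i \sum_p F (mxtens_index (i, p)).
Proof.
rewrite pair_bigA /= (reindex (@mxtens_index n l)).
  by apply: eq_bigr => -[i p].
exists (@mxtens_unindex n l) => x _; [exact: mxtens_indexK|exact: mxtens_unindexK].
Qed.

Lemma block_inj n l (X Y : 'M[C]_(n * l)) :
  (forall p q, block X p q = block Y p q) -> X = Y.
Proof.
move=> XY; apply/matrixP => i j.
case: (mxtens_indexP i) => i0 p; case: (mxtens_indexP j) => j0 q.
by have /matrixP/(_ i0 j0) := XY p q; rewrite !mxE.
Qed.

Lemma block_tens n l (A : 'M[C]_n) (B : 'M[C]_l) p q :
  block (tensmx A B) p q = B p q *: A.
Proof. by apply/matrixP => i j; rewrite !mxE !mxtens_indexK mulrC. Qed.

Lemma block_sum n l (I : finType) (F : I -> 'M[C]_(n * l)) p q :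
  block (\sum_i F i) p q = \sum_i block (F i) p q.
Proof.
by apply/matrixP => i j; rewrite mxE !summxE; apply: eq_bigr => k _; rewrite mxE.
Qed.

Lemma blockB n l (X Y : 'M[C]_(n * l)) p q :
  block (X - Y) p q = block X p q - block Y p q.
Proof. by apply/matrixP => i j; rewrite !mxE. Qed.

Lemma block_adj n l (X : 'M[C]_(n * l)) p q :
  block X^H p q = (block X q p)^H.
Proof. by rewrite !adjmxE; apply/matrixP => i j; rewrite !mxE. Qed.

Lemma blockM n l (X Y : 'M[C]_(n * l)) p q :
  block (X *m Y) p q = \sum_r block X p r *m block Y r q.
Proof.
apply/matrixP => i j; rewrite !mxE sum_mxtens summxE exchange_big /=.
by apply: eq_bigr => r _; rewrite mxE; apply: eq_bigr => k _; rewrite !mxE.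
Qed.

Lemma tr_block n l (X : 'M[C]_(n * l)) : \tr X = \sum_p \tr (block X p p).
Proof.
rewrite {1}/mxtrace sum_mxtens exchange_big /=; apply: eq_bigr => p _.
by apply: eq_bigr => i _; rewrite mxE.
Qed.

Lemma tr_blockM n l (X Y : 'M[C]_(n * l)) :
  \tr (X *m Y) = \sum_p \sum_q \tr (block X p q *m block Y q p).
Proof.
by rewrite tr_block; apply: eq_bigr => p _; rewrite blockM raddf_sum.
Qed.

Lemma rtr_block_gram n l (X : 'M[C]_(n * l)) :
  rtr (X *m X^H) = \sum_p \sum_q rtr (block X p q *m (block X p q)^H).
Proof.
rewrite rtrE tr_blockM raddf_sum; apply: eq_bigr => p _; rewrite raddf_sum.
by apply: eq_bigr => q _; rewrite rtrE block_adj.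
Qed.

Lemma block_tensid n l (Phi : 'M[C]_n -> 'M[C]_n) (X : 'M[C]_(n * l)) p q :
  block (tensid Phi X) p q = Phi (block X p q).
Proof.
rewrite /tensid block_sum (bigD1 p)//= block_sum (bigD1 q)//= block_tens.
rewrite mxE !eqxx scale1r big1 => [|q' q'q]; last first.
  by rewrite block_tens mxE eqxx eq_sym (negbTE q'q) andbF scale0r.
rewrite addr0 big1 ?addr0// => p' p'p; rewrite block_sum big1// => q' _.
by rewrite block_tens mxE eq_sym (negbTE p'p) scale0r.
Qed.

Lemma block_tens1l n l (A : 'M[C]_n) (X : 'M[C]_(n * l)) p q :
  block (tensmx A 1%:M *m X) p q = A *m block X p q.
Proof.
rewrite blockM (bigD1 p)//= block_tens mxE eqxx scale1r big1 ?addr0// => r rp.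
by rewrite block_tens mxE eq_sym (negbTE rp) scale0r mul0mx.
Qed.

Lemma block_tens1r n l (A : 'M[C]_n) (X : 'M[C]_(n * l)) p q :
  block (X *m tensmx A 1%:M) p q = block X p q *m A.
Proof.
rewrite blockM (bigD1 q)//= block_tens mxE eqxx scale1r big1 ?addr0// => r rp.
by rewrite block_tens mxE (negbTE rp) scale0r mulmx0.
Qed.

End Blocks.

(** * Spectral gap and Pimsner-Popa constant valid for every ampliation *)

Section Ampliation.
Context {R : realType}.
Local Notation C := R[i].
Variables (n k : nat) (a : 'I_k -> 'M[C]_n).
Hypothesis ha : forall j, (a j)^H = a j.

Definition ampliation l (j : 'I_k) : 'M[C]_(n * l) := tensmx (a j) 1%:M.

Lemma ampliation_adj l j : (ampliation l j)^H = ampliation l j.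
Proof.
apply: block_inj => p q; rewrite block_adj !block_tens !mxE eq_sym.
by case: eqP => _; rewrite ?scale1r ?scale0r ?ha//= adjmxE trmx0 map_mx0.
Qed.

Lemma commutes_ampliation l (X : 'M[C]_(n * l)) :
  commutes (ampliation l) X <-> forall p q, commutes a (block X p q).
Proof.
split=> cX.
  by move=> p q j; rewrite -block_tens1r -block_tens1l cX.
by move=> j; apply: block_inj => p q; rewrite block_tens1r block_tens1l cX.
Qed.

Lemma block_commutator l j (X : 'M[C]_(n * l)) p q :
  block (commutator (ampliation l j) X) p q = commutator (a j) (block X p q).
Proof. by rewrite /commutator blockB block_tens1l block_tens1r. Qed.

Lemma tensid_lindblad l (X : 'M[C]_(n * l)) :
  tensid (lindblad a) X = lindblad (ampliation l) X.
Proof.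
apply: block_inj => p q; rewrite block_tensid /lindblad block_sum.
apply: eq_bigr => j _; rewrite blockB.
have -> : block (ampliation l j *m ampliation l j *m X
    + X *m (ampliation l j *m ampliation l j)) p q =
    a j *m a j *m block X p q + block X p q *m (a j *m a j).
  have -> : forall Y Z : 'M[C]_(n * l),
      block (Y + Z) p q = block Y p q + block Z p q.
    by move=> Y Z; apply/matrixP => i i'; rewrite !mxE.
  by rewrite -mulmxA !block_tens1l !mulmxA !block_tens1r.
congr (_ - _); apply/matrixP => i i'; rewrite [RHS]mxE [in RHS]mxE mxE.
by rewrite -block_tens1l -block_tens1r [in LHS]mxE.
Qed.

(** Blockwise, the commutant of the a_j (x) 1 consists of the matrices with blocks in N. Hence
    everything shown for a general family b applies to the ampliated one. *)
Lemma tensid_condexp l (X : 'M[C]_(n * l)) :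
  is_condexp (ampliation l) X (tensid (condexp (commutant a)) X).
Proof.
split.
  apply/commutes_ampliation => p q; rewrite block_tensid.
  exact/commutantP/condexp_in.
move=> Y /commutes_ampliation cY; rewrite tr_blockM big1// => p _.
rewrite big1// => q _; rewrite blockB block_tensid.
rewrite -[block Y q p]adjK adjmxE; apply: condexp_orth.
by apply/commutantP; apply: commutes_adj.
Qed.

Lemma tr_gram_ge0 m (V : 'M[C]_m) : 0 <= \tr (V *m V^H).
Proof.
rewrite /mxtrace sumr_ge0// => i _; rewrite mxE sumr_ge0// => j _.
by rewrite adjmxE !mxE mulcJ_ge0.
Qed.

(** A crude substitute for the operator norm, from which both the gap and the constant c are
    made. *)
Lemma posmx_le_rtr m (A : 'M[C]_m) : posmx A -> posmx (((rtr A)%:C)%:M - A).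
Proof.
move=> pA; have [U [d [UU U'U AE fE]]] := spectral_herm (posmx_adj pA).
have d0 := spectral_posmx UU AE pA.
have rA : rtr A = \sum_i d i.
  rewrite {1}AE rtrC mulmxA UU mul1mx rtrE raddf_sum.
  by apply: eq_bigr => i _; rewrite rdiagE eqxx.
have -> : ((rtr A)%:C)%:M - A = U^H *m rdiag (fun i => rtr A - d i) *m U.
  rewrite (_ : rdiag _ = ((rtr A)%:C)%:M - rdiag d); last first.
    by apply/matrixP => i j; rewrite !mxE !rdiagE rmorphB mulrnBl.
  rewrite mulmxBr mulmxBl -AE; congr (_ - _).
  by rewrite scalar_mxC -mulmxA U'U mulmx1.
rewrite -[X in _ *m X](adjK U); apply: posmx_conj; apply: posmx_rdiag => i.
by rewrite rA (bigD1 i)//= addrAC subrr add0r sumr_ge0.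
Qed.

(** K is the projection onto the kernel of [A], T its square root and S the pseudo-inverse of T,
    thanks to 0^-1 = 0. *)
Lemma spectral_kernel m (A : 'M[C]_m) : posmx A -> exists K S T : 'M[C]_m,
  [/\ [/\ K^H = K, S^H = S & T^H = T],
    [/\ K *m K = K, K *m A = 0 & T *m T = A],
    T *m S + K = 1%:M &
    forall X, A *m X = X *m A -> K *m X = X *m K].
Proof.
move=> pA; have hA := posmx_adj pA.
exists (fcalc (fun x : R => (x == 0)%:R) A),
  (fcalc (fun x : R => (Num.sqrt x)^-1) A), (fcalc Num.sqrt A); split.
- by split; exact: fcalc_adj.
- split.
  + by rewrite (fcalcM _ _ hA); apply: eq_fcalc => x; rewrite -natrM mulnb andbb.
  + rewrite -{2}(fcalc_id hA) (fcalcM _ _ hA).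
    rewrite (_ : (fun _ => _) = fun=> 0).
      by rewrite (fcalc_cst _ hA); apply/matrixP => i j; rewrite !mxE mul0rn.
    by apply/funext => x; case: eqP => [->|_]; rewrite ?mulr0 ?mul0r.
  + rewrite (fcalcM _ _ hA) -[RHS](fcalc_id hA); apply: eq_fcalc_pos => // x x0.
    by rewrite -expr2 sqr_sqrtr.
- rewrite (fcalcM _ _ hA) (fcalcD _ _ hA).
  have -> : (1%:M : 'M[C]_m) = fcalc (fun=> 1) A by rewrite fcalc_cst.
  apply: eq_fcalc_pos => // x x0; have [->|xn0] := eqVneq x 0.
    by rewrite sqrtr0 mul0r add0r.
  by rewrite addr0 mulfV// sqrtr_eq0 -ltNge lt_neqAle eq_sym xn0.
- by move=> X; exact: fcalc_comm.
Qed.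

Lemma mulmx_complement m p (u : 'M[C]_(p, m)) (A K : 'M[C]_m) :
  u *m K = 0 -> A + K = 1%:M -> u *m A = u.
Proof. by move=> uK AK; rewrite -[RHS]mulmx1 -AK mulmxDr uK addr0. Qed.

Lemma rtr_posmx_ge0 m (A : 'M[C]_m) : posmx A -> 0 <= rtr A.
Proof.
by move=> pA; rewrite -[A]mulmx1; apply: rtr_mul_posmx; [|exact: posmx1].
Qed.

(** Off the kernel v = w S with w = v T, so |v|^2 = w S^2 w^H <= tr (S^2) |w|^2 and |w|^2 = v A v^H.
    Adding 1 to tr (S^2) makes the inverse meaningful when S = 0. *)
Lemma quadratic_gap m (A : 'M[C]_m) : posmx A -> exists (K : 'M[C]_m) (g : R),
  [/\ K^H = K, K *m K = K, K *m A = 0, 0 < g &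
   forall v : 'rV_m, v *m K = 0 ->
     g * complex.Re ((v *m v^H) 0 0) <= complex.Re ((v *m A *m v^H) 0 0)].
Proof.
move=> /spectral_kernel[K [S [T [[hK hS hT] [KK KA TT] TS _]]]].
pose Q := S *m S.
have pQ : posmx Q by rewrite /Q -{2}hS; exact: posmx_gram.
have Q0 := rtr_posmx_ge0 pQ.
exists K, (rtr Q + 1)^-1; split => //; first by rewrite invr_gt0 ltr_wpDl.
move=> v vK; have vE : v *m T *m S = v.
  by rewrite -mulmxA; exact: mulmx_complement vK TS.
have -> : v *m A *m v^H = (v *m T) *m (v *m T)^H.
  by rewrite adjM hT -TT !mulmxA.
have -> : v *m v^H = (v *m T) *m Q *m (v *m T)^H.
  by rewrite -{1 2}vE adjM hS /Q !mulmxA.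
move: (v *m T) => w.
have := (posmxE _).1 (posmx_le_rtr pQ) w.
rewrite mulmxBr mulmxBl scalar_mxC mul_scalar_mx -scalemxAl.
have : 0 <= (w *m w^H) 0 0.
  by have := (posmxE 1%:M).1 (@posmx1 _ _) w; rewrite mulmx1.
move: (w *m w^H) (w *m Q *m w^H) => W V; rewrite !lecE !mxE.
case: (V 0 0) (W 0 0) => [V1 V2] [W1 W2]; simpc => /= /andP[_ W0] /andP[_ VW].
rewrite mulrC ler_pdivrMr ?ltr_wpDl//; rewrite subr_ge0 in VW.
by rewrite (le_trans VW)// mulrC ler_wpM2l// lerDl.
Qed.

Lemma lindblad_is_linear : linear (lindblad a).
Proof.
move=> c x y; rewrite /lindblad scaler_sumr -big_split; apply: eq_bigr => j _.
rewrite /= !mulmxDr !mulmxDl -!scalemxAr -!scalemxAl.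
move: (_ *m x) (_ *m y) (x *m _) (y *m _) (_ *m x *m _) (_ *m y *m _).
move=> x1 x2 x3 y1 y2 y3.
by apply/matrixP => i i'; rewrite !mxE; ring.
Qed.

HB.instance Definition _ :=
  GRing.isLinear.Build _ _ _ _ (lindblad a) lindblad_is_linear.

(* x |-> L x is a positive matrix on 'M_n for the trace inner product, so that
   its pseudo-inverse is bounded and its kernel is the commutant. *)
Lemma exists_gap : exists2 g : R, 0 < g & spectral_gap a g.
Proof.
pose M := lin_mx (lindblad a).
have ME x : mxvec x *m M = mxvec (lindblad a x) by rewrite mul_vec_lin.
have formE x : (mxvec x *m M *m (mxvec x)^H) 0 0 =
    \sum_j \tr (commutator (a j) x *m (commutator (a j) x)^H).
  rewrite ME adjmxE -mxtrace_mxvec -adjmxE tr_lindblad -sumrN.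
  apply: eq_bigr => j _.
  have -> : (commutator (a j) x)^H = - commutator (a j) x^H.
    by rewrite /commutator adjB !adjM ha opprB.
  by rewrite mulmxN raddfN.
have pM : posmx M.
  apply/posmxE => u; rewrite -[u]vec_mxK formE sumr_ge0// => j _.
  exact: tr_gram_ge0.
have [P0 [g [hP P0P0 P0M g0 gP]]] := quadratic_gap pM.
exists g => // z oz; pose v := mxvec z.
(* The form vanishes at the kernel component x0 of z, so all commutators of x0 vanish; x0 lies in
   the commutant, to which z is orthogonal. *)
have vP0 : v *m P0 = 0.
  pose x0 := vec_mx (v *m P0).
  have x0E : mxvec x0 = v *m P0 by rewrite vec_mxK.
  have := formE x0; rewrite x0E -(mulmxA v) P0M mulmx0 mul0mx mxE => /esym/eqP.
  rewrite psumr_eq0 => [/allP c0|j _]; last exact: tr_gram_ge0.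
  have cx0 : commutes a x0.
    move=> j; have /eqP/rtr_tr/rtr_gram_eq0 := c0 j (mem_index_enum _).
    by move=> /eqP; rewrite subr_eq0 => /eqP.
  have := oz _ (commutes_adj ha cx0); rewrite adjmxE mxtrace_mxvec x0E -adjmxE.
  rewrite -[v in v *m _]/(mxvec z) -/v adjM hP mulmxA => e.
  apply: rtr_gram_eq0; rewrite rtrE adjM hP mulmxA -(mulmxA v) P0P0.
  by rewrite /mxtrace big_ord_recl big_ord0 addr0 e.
have -> : rtr (z *m z^H) = complex.Re ((v *m v^H) 0 0).
  by rewrite rtrE adjmxE mxtrace_mxvec -adjmxE.
have -> : \sum_j rtr (commutator (a j) z *m (commutator (a j) z)^H) =
    complex.Re ((v *m M *m v^H) 0 0).
  by rewrite formE raddf_sum; apply: eq_bigr => j _; rewrite rtrE.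
exact: gP.
Qed.

(** Both sides are sums over blocks, so [g] is unchanged. Block (p, q) is orthogonal to the
    commutant by testing against y (x) E_qp. *)
Lemma gap_ampliation g l : spectral_gap a g -> spectral_gap (ampliation l) g.
Proof.
move=> gap z oz; rewrite rtr_block_gram mulr_sumr.
under [leRHS]eq_bigr do rewrite rtr_block_gram.
rewrite exchange_big /=; apply: ler_sum => p _; rewrite mulr_sumr.
rewrite exchange_big /=; apply: ler_sum => q _.
under eq_bigr do rewrite block_commutator.
apply: gap => y cy.
have := oz (tensmx y (delta_mx q p)); rewrite tr_blockM.
rewrite (bigD1 p)//= (bigD1 q)//= block_tens mxE !eqxx scale1r.
rewrite big1 => [|q' q'q]; last first.
  by rewrite block_tens mxE (negbTE q'q) scale0r mulmx0 mxtrace0.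
rewrite addr0 big1 ?addr0 => [|p' p'p]; last first.
  by rewrite big1// => q' _;
    rewrite block_tens mxE (negbTE p'p) andbF scale0r mulmx0 mxtrace0.
apply; apply/commutes_ampliation => p' q' j.
by rewrite block_tens -scalemxAl cy scalemxAr.
Qed.

(** The unnormalised maximally entangled vector, the sum of the e_i (x) e_i. *)
Definition choi_vector : 'rV[C]_(n * n) :=
  \row_r ((mxtens_unindex r).1 == (mxtens_unindex r).2)%:R.

(** The correspondence between vectors and matrices: B is [v] reshaped to size n x l. *)
Lemma choi_vectorM l (v : 'rV[C]_(n * l)) :
  v = choi_vector *m
      tensmx 1%:M (\matrix_(i, p) v 0 (mxtens_index (i, p))).
Proof.
apply/rowP => r; case: (mxtens_indexP r) => i p.
rewrite mxE sum_mxtens (bigD1 i)//= (bigD1 i)//= big1 => [|j ji]; last first.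
  by rewrite !mxE !mxtens_indexK /= eq_sym (negbTE ji) mul0r.
rewrite big1 => [|j ji]; last first.
  rewrite big1// => q _.
  by rewrite !mxE !mxtens_indexK /= (negbTE ji) mul0r mulr0.
by rewrite !mxE !mxtens_indexK /= !eqxx !mul1r !addr0.
Qed.

(* Every rank-one positive operator is the image of the Choi projection under
   a conjugation by some 1 (x) B, which commutes with the ampliation of E_N. *)
Lemma pimsner_popa : exists2 c : R, 1 <= c & forall l (X Y : 'M[C]_(n * l)),
  posmx X -> is_condexp (ampliation l) X Y -> posmx (Y - (c^-1)%:C *: X).
Proof.
pose W := choi_vector^H *m choi_vector.
pose P := tensid (condexp (commutant a)) W.
have WP : is_condexp (ampliation n) W P := tensid_condexp W.
have hb := ampliation_adj n.
have pW : posmx W by rewrite /W -{2}[choi_vector]adjK; exact: posmx_gram.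
have pP : posmx P := condexp_pos hb pW WP.
have [K [S [T [[hK hS hT] [KK KP TT] TS cKP]]]] := spectral_kernel pP.
have ST : S *m T + K = 1%:M.
  by rewrite -(adj1 _) -TS adjD adjM hS hT hK.
have cK : commutes (ampliation n) K.
  by move=> j; apply: cKP; have [->] := WP.
(* P may be singular, but its kernel annihilates the Choi vector: K lies in the commutant, so tr (W
   K) = tr (P K) = 0. *)
have choiK : choi_vector *m K = 0.
  apply: rtr_gram_eq0; rewrite adjM hK mulmxA -(mulmxA choi_vector) KK.
  by rewrite rtrC mulmxA (condexp_rtr WP cK) rtrC KP rtr0.
have choiE : choi_vector *m S *m T = choi_vector.
  by rewrite -mulmxA; exact: mulmx_complement choiK ST.
pose V := (choi_vector *m S)^H *m (choi_vector *m S).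
have pV : posmx V by rewrite /V -{2}[_ *m S]adjK; exact: posmx_gram.
have V0 : 0 <= rtr V.
  exact: rtr_posmx_ge0.
(* W = T V T <= c T^2 = c P, as V <= tr V; the summand 1 ensures c >= 1. The construction takes
   place at ampliation size n, before any l is given. *)
pose c := rtr V + 1.
have c0 : 0 < c by rewrite ltr_wpDl.
have WPc : posmx (P - (c^-1)%:C *: W).
  have WE : W = T *m V *m T.
    by rewrite /W -{1 2}choiE adjM hT /V !mulmxA.
  have pc : posmx ((c%:C)%:M - V).
    have -> : (c%:C)%:M - V = 1%:M + (((rtr V)%:C)%:M - V).
      rewrite addrA; congr (_ - _); apply/matrixP => i j.
      by rewrite !mxE /c rmorphD rmorph1 mulrnDl addrC.
    by apply: posmxD; [exact: posmx1|exact: posmx_le_rtr].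
  have -> : P - (c^-1)%:C *: W = (c^-1)%:C *: (T *m ((c%:C)%:M - V) *m T^H).
    rewrite hT mulmxBr mulmxBl scalerBr -WE; congr (_ - _).
    rewrite scalar_mxC mul_scalar_mx -scalemxAl TT scalerA -rmorphM.
    by rewrite mulVf ?gt_eqF// scale1r.
  by apply: posmxZ; [rewrite invr_ge0 ltW|exact: posmx_conj].
have conjc l (B : 'M[C]_(n, l)) : is_condexp (ampliation l)
    ((tensmx 1%:M B)^H *m W *m tensmx 1%:M B)
    ((tensmx 1%:M B)^H *m P *m tensmx 1%:M B).
  have inter j : tensmx 1%:M B *m ampliation l j =
      ampliation n j *m tensmx 1%:M B.
    by rewrite /ampliation !tensmx_mul !mul1mx !mulmx1.
  have inter' j : ampliation l j *m (tensmx 1%:M B)^H =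
      (tensmx 1%:M B)^H *m ampliation n j.
    by rewrite -[ampliation l j]ampliation_adj -adjM inter adjM ampliation_adj.
  have [cP oP] := WP; split.
    by move=> j; rewrite -mulmxA inter mulmxA -(mulmxA _ P) cP !mulmxA inter'.
  move=> y cy; rewrite -mulmxBl -mulmxBr -!mulmxA mxtrace_mulC -!mulmxA.
  apply: oP => j; rewrite -!mulmxA -inter' (mulmxA y) cy -mulmxA.
  by rewrite !mulmxA inter.
exists c; first by rewrite lerDr.
move=> l X Y pX XY; have [Z [hZ XE _]] := posmx_sqrt pX.
(* X = Z^H Z is the sum of the rank-one operators given by the rows of the root Z; each row is
   reshaped to pull it back to the Choi vector. *)
pose B (i : 'I_(n * l)) : 'M[C]_(n, l) :=
  \matrix_(j, p) (row i Z) 0 (mxtens_index (j, p)).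
have XS : X = \sum_i (tensmx 1%:M (B i))^H *m W *m tensmx 1%:M (B i).
  rewrite XE -{1}hZ; transitivity (\sum_i (row i Z)^H *m row i Z).
    apply/matrixP => i j; rewrite mxE summxE; apply: eq_bigr => r _.
    by rewrite mxE big_ord_recl big_ord0 addr0 !adjmxE !mxE.
  apply: eq_bigr => i _; rewrite [in LHS](choi_vectorM (row i Z)) -/(B i).
  by rewrite adjM /W !mulmxA.
have -> : Y = \sum_i (tensmx 1%:M (B i))^H *m P *m tensmx 1%:M (B i).
  apply: (condexp_uniq (ampliation_adj l) XY).
  by rewrite XS; apply: condexp_sum => i; exact: conjc.
rewrite XS scaler_sumr -sumrB; apply: posmx_sum => i.
rewrite scalemxAl scalemxAr -mulmxBl -mulmxBr.
by rewrite -[X in _ *m X]adjK; exact: posmx_conj.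
Qed.

End Ampliation.

(** * Limits at singular operators *)

Section Limits.
Context {R : realType}.
Local Notation C := R[i].

Fact xlnx_arith (s l : R) : 0 <= s -> s * - l <= 1 - s ->
  - (2 * s) <= s * s * (l + l).
Proof. by nra. Qed.

(** At d = 0 the squeeze uses e ln e >= - 2 sqrt e, which is ln y <= y - 1 at y = 1 / sqrt e. *)
Lemma cvg_xlnx_right (d : R) : 0 <= d ->
  (d + e) * ln (d + e) @[e --> 0^'+] --> d * ln d.
Proof.
rewrite le_eqVlt => /predU1P[<-|d0].
  rewrite mul0r; apply: (@squeeze_cvgr _ _ _ _ (fun x => - (2 * Num.sqrt x)) (fun=> 0)).
  - near=> e; rewrite add0r.
    have e0 : 0 < e by near: e; exact: nbhs_right_gt.
    have e1 : e <= 1 by near: e; exact: nbhs_right_le.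
    have s0 : 0 < Num.sqrt e by rewrite sqrtr_gt0.
    have eE : e = Num.sqrt e ^+ 2 by rewrite sqr_sqrtr// ltW.
    have l0 : e * ln e <= 0 by rewrite pmulr_rle0// ln_le0.
    rewrite l0 andbT.
    have : ln (Num.sqrt e)^-1 <= (Num.sqrt e)^-1 - 1.
      have := @le_ln1Dx R ((Num.sqrt e)^-1 - 1).
      rewrite [1 + (_^-1 - 1)]addrC subrK; apply.
      by rewrite ltrBrDl subrr invr_gt0.
    rewrite lnV ?posrE// => lnb.
    rewrite {2 3}eE expr2 lnM ?posrE//.
    have := ler_wpM2l (ltW s0) lnb; rewrite mulrBr mulfV ?gt_eqF// mulr1.
    exact: xlnx_arith (ltW s0).
  - rewrite -[X in _ --> X]oppr0; apply: cvgN; rewrite -[X in _ --> X](mulr0 2).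
    apply: cvgMr; apply: cvg_at_right_filter; rewrite -[X in _ --> X](@sqrtr0 R).
    exact: sqrt_continuous.
  - exact: cvg_cst.
apply: cvg_at_right_filter.
have cD : d + e @[e --> 0] --> d.
  by rewrite -[X in _ --> X]addr0; apply: cvgD; [exact: cvg_cst|exact: cvg_id].
apply: cvgM => //; apply: (@cvg_comp _ _ _ (fun e => d + e) (@ln R) _ (nbhs d)) => //.
exact: continuous_ln.
Unshelve. all: by end_near. Qed.

Lemma cvg_sum_seq (T I : Type) (F : set_system T) (FF : Filter F) (r : seq I)
    (f : I -> T -> R) (l : I -> R) : (forall i, f i x @[x --> F] --> l i) ->
  \sum_(i <- r) f i x @[x --> F] --> \sum_(i <- r) l i.
Proof.
move=> fl; elim: r => [|i r IH].
  by rewrite big_nil; under eq_fun do rewrite big_nil; exact: cvg_cst.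
by rewrite big_cons; under eq_fun do rewrite big_cons; exact: cvgD.
Qed.

Lemma mul_mxlog_regularize m (A : 'M[C]_m) (e : R) : posmx A -> 0 < e ->
  regularize A e *m mxlog (regularize A e) =
  fcalc (fun x => (x + e) * ln (x + e)) A.
Proof.
move=> pA e0; have hA := posmx_adj pA.
have pAe := posmx_regularize e0 pA; have hAe := posdefmx_adj pAe.
rewrite mxlog_fcalc -[X in X *m _](fcalc_id hAe) (fcalcM _ _ hAe).
by rewrite (fcalc_regularize _ _ hA).
Qed.

Lemma is_cvg_entropy_regularize m (A : 'M[C]_m) : posmx A ->
  cvg (rtr (regularize A e *m mxlog (regularize A e)) @[e --> 0^'+]).
Proof.
move=> pA; have [d [w [_ /(_ pA) d0 _ fE]]] := rtr_fcalc 1%:M (posmx_adj pA).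
apply/cvg_ex; exists (\sum_i w i * (d i * ln (d i))).
apply: (@cvg_trans _ ((\sum_i w i * ((d i + e) * ln (d i + e))) @[e --> 0^'+])).
  apply: near_eq_cvg; near=> e.
  have e0 : 0 < e by near: e; exact: nbhs_right_gt.
  by rewrite (mul_mxlog_regularize pA e0) -[fcalc _ _]mul1mx fE.
by apply: cvg_sum_seq => i; apply: cvgMr; exact: cvg_xlnx_right.
Unshelve. all: by end_near. Qed.

End Limits.

(** * The inequality for definite operators and its limit *)

Section CompleteInequality.
Context {R : realType}.
Local Notation C := R[i].
Variables (n k : nat) (a : 'I_k -> 'M[C]_n).
Hypothesis ha : forall j, (a j)^H = a j.
Local Notation E := (condexp (commutant a)).

Lemma lindblad_regularize m (b : 'I_k -> 'M[C]_m) x s :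
  lindblad b (regularize x s) = lindblad b x.
Proof.
rewrite /regularize linearD /= [X in _ + X]big1 ?addr0// => j _.
rewrite mul_mx_scalar mul_scalar_mx mul_mx_scalar -scalemxAl.
by rewrite scaler_nat mulr2n subrr.
Qed.

Lemma mxlog_adj m (A : 'M[C]_m) : A^H = A -> (mxlog A)^H = mxlog A.
Proof. by move=> hA; rewrite mxlog_fcalc fcalc_adj. Qed.

Lemma relentE l (rho sigma : 'M[C]_(n * l)) : rho^H = rho ->
  is_condexp (ampliation a l) rho sigma ->
  relent (commutant a) rho =
  (rtr (rho *m mxlog rho) - rtr (rho *m mxlog sigma))%:C.
Proof.
move=> hr cs; have hb := ampliation_adj ha l.
have hs := condexp_herm hb hr cs.
have e1 := tr_hermM hr (mxlog_adj hr); have e2 := tr_hermM hr (mxlog_adj hs).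
have sE : tensid E rho = sigma.
  exact: (condexp_uniq hb (tensid_condexp ha rho) cs).
rewrite /relent sE raddfB rmorphB.
exact: (congr2 (fun x y : C => x - y) e1 e2).
Qed.

(** As log sigma lies in the commutant, the relative entropy is a difference of two entropies, each
    with a finite limit at singular operators. *)
Lemma relent_condexp l (rho sigma : 'M[C]_(n * l)) : rho^H = rho ->
  is_condexp (ampliation a l) rho sigma ->
  relent (commutant a) rho =
  (rtr (rho *m mxlog rho) - rtr (sigma *m mxlog sigma))%:C.
Proof.
move=> hr cs; have hs := condexp_herm (ampliation_adj ha l) hr cs.
have clog : commutes (ampliation a l) (mxlog sigma).
  by rewrite mxlog_fcalc; apply: commutes_fcalc; [exact: hs|case: cs].
rewrite (relentE hr cs); congr (_ - _)%:C; exact: condexp_rtr cs clog.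
Qed.

Lemma entprodE l (rho : 'M[C]_(n * l)) : rho^H = rho ->
  entprod (lindblad a) rho =
  (rtr (lindblad (ampliation a l) rho *m mxlog rho))%:C.
Proof.
move=> hr; rewrite /entprod tensid_lindblad tr_hermM ?mxlog_adj//.
rewrite /lindblad adj_sum; apply: eq_bigr => j _.
rewrite adjB adjD !adjM hr !(ampliation_adj ha) !mulmxA.
have -> : (2%:R : C) = (2%:R : R)%:C by rewrite rmorph_nat.
rewrite adjZ !adjM hr !(ampliation_adj ha) !mulmxA.
by congr (_ + _); exact: addrC.
Qed.

Lemma clsi_posdef (g c : R) l (rho : 'M[C]_(n * l)) :
  0 < g -> 1 <= c -> spectral_gap a g ->
  (forall l (X Y : 'M[C]_(n * l)), posmx X ->
     is_condexp (ampliation a l) X Y -> posmx (Y - (c^-1)%:C *: X)) ->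
  posdefmx rho ->
  (g / (2 * c ^+ 2))%:C * relent (commutant a) rho <=
  entprod (lindblad a) rho.
Proof.
move=> g0 c1 gap pp pr; have hr := posdefmx_adj pr.
have c0 : 0 < c by rewrite (lt_le_trans ltr01).
have cs := tensid_condexp ha rho.
have rs := pp _ _ _ (posdef_posmx pr) cs.
(* Definiteness of sigma comes from sigma >= rho / c. *)
have ps : posdefmx (tensid E rho).
  rewrite -[tensid E rho](subrK ((c^-1)%:C *: rho)) addrC.
  by apply: posdefmxD => //; apply: posdefmxZ => //; rewrite invr_gt0.
have := entropy_le_fisher (ampliation_adj ha l) g0 c1 (gap_ampliation gap) pr ps cs rs.
rewrite (relentE hr cs) (entprodE hr) -rmorphM lecR => le.
have lam0 : 0 < g / (2 * c ^+ 2) by rewrite divr_gt0// mulr_gt0// exprn_gt0.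
by rewrite -ler_pdivlMl// invf_div; move: le; rewrite !mulrA.
Qed.

Lemma is_cvg_relent l (rho : 'M[C]_(n * l)) : posmx rho ->
  cvg ((complex.Re (relent (commutant a) (regularize rho e)))%:E @[e --> 0^'+]).
Proof.
move=> pr; have hr := posmx_adj pr.
have cs := tensid_condexp ha rho.
have hb := ampliation_adj ha l.
have ps := condexp_pos hb pr cs.
have /cvg_ex[x xP] := is_cvg_entropy_regularize pr.
have /cvg_ex[y yP] := is_cvg_entropy_regularize ps.
apply/cvg_ex; exists (x - y)%:E; apply/cvg_EFin; first exact: nearW.
apply: cvg_trans (cvgB xP yP); apply: near_eq_cvg; near=> e.
have e0 : 0 < e by near: e; exact: nbhs_right_gt.
have pse := posmx_regularize e0 ps; have pre := posmx_regularize e0 pr.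
have cse := condexp_regularize e cs.
exact/esym/(congr1 (@complex.Re R) (relent_condexp (posdefmx_adj pre) cse)).
Unshelve. all: by end_near. Qed.

(** The shift leaves L(rho) unchanged and the derivative in e is minus a Fisher information. The
    entropy production is thus nonincreasing in e, and its limit at 0+ exists as an extended
    real. *)
Lemma is_cvg_entprod l (rho : 'M[C]_(n * l)) : posmx rho ->
  cvg ((complex.Re (entprod (lindblad a) (regularize rho e)))%:E @[e --> 0^'+]).
Proof.
move=> pr; have hr := posmx_adj pr; have hb := ampliation_adj ha l.
apply: nonincreasing_at_right_is_cvge; near=> x => s t.
rewrite !in_itv /= => /andP[s0 _] /andP[t0 _] st.
have psr := posmx_regularize s0 pr; have ptr := posmx_regularize t0 pr.
rewrite lee_fin (entprodE (posdefmx_adj psr)) (entprodE (posdefmx_adj ptr)).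
rewrite [leLHS]/= [leRHS]/= !lindblad_regularize.
apply: (rtr_ln_antitone pr s0 st) => r r0.
exact: (rtr_lindblad_le0 hb hr (posmx_regularize r0 pr)).
Unshelve. all: by end_near. Qed.

Lemma clsi_pos : exists lambda : R,
  0 < lambda /\ clsi_ineq (lindblad a) (commutant a) lambda.
Proof.
have [g g0 gap] := exists_gap ha; have [c c1 pp] := pimsner_popa ha.
have c0 : 0 < c by rewrite (lt_le_trans ltr01).
pose lambda := g / (2 * c ^+ 2); exists lambda.
split; first by rewrite divr_gt0// mulr_gt0// exprn_gt0.
move=> l rho _; split; first exact: clsi_posdef g0 c1 gap pp.
move=> pr; have cf := is_cvg_relent pr.
rewrite -limeMl//; apply: lee_lim; [exact: is_cvgeZl|exact: is_cvg_entprod|].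
near=> e; have e0 : 0 < e by near: e; exact: nbhs_right_gt.
have pre := posmx_regularize e0 pr.
have := clsi_posdef g0 c1 gap pp pre.
have cse := tensid_condexp ha (regularize rho e).
rewrite (relentE (posdefmx_adj pre) cse) (entprodE (posdefmx_adj pre)).
by rewrite -rmorphM lecR -EFinM lee_fin.
Unshelve. all: by end_near. Qed.

End CompleteInequality.

Theorem corollary1p2 (R : realType) (n k : nat) (a : 'I_k -> 'M[R[i]]_n)
    (hn : (0 < n)%N) (ha : forall j : 'I_k, a j \is hermsymmx) :
  (0 < CLSI (lindblad a) (commutant a))%E /\
  exists lambda : R,
    0 < lambda /\ clsi_ineq (lindblad a) (commutant a) lambda.
Proof.
have [lambda [l0 ineq]] := clsi_pos (fun j => hermsymmx_adj (ha j)).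
split; last by exists lambda.
apply: (@lt_le_trans _ _ lambda%:E); first by rewrite lte_fin.
by apply: ereal_sup_ubound; exists lambda.
Qed.
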